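(* Let $G$ be a finite simple decomposable graph. Then $\chi_{\mathrm{irr}}'(G) \le 220$.
   Context: All graphs are finite and simple. A graph is locally irregular if for every vertex $v$ all neighbors of $v$ have degrees distinct from the degree of $v$ (equivalently, any two adjacent vertices have distinct degrees). A locally irregular edge-coloring of a graph $G$ is a (not necessarily proper) edge-coloring of $G$ such that, for every color, the subgraph formed by the edges of that color is locally irregular. A graph is decomposable if it admits a locally irregular edge-coloring. For a decomposable graph $G$, the locally irregular chromatic index $\chi_{\mathrm{irr}}'(G)$ is the smallest number of colors in a locally irregular edge-coloring of $G$. *)

(* Defs.v *)
From mathcomp Require Import all_boot.

Set Implicit Arguments.
Unset Strict Implicit.
Unset Printing Implicit Defensive.

Record sgraph := SGraph {
  vertex :> finType;
  adj : rel vertex;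
  adj_sym : symmetric adj;
  adj_irrefl : irreflexive adj }.

Definition edges (G : sgraph) : {set {set G}} :=
  [set [set p.1; p.2] | p : G * G & adj p.1 p.2].

Definition edge (G : sgraph) : finType := {f : {set G} | f \in edges G}.

Definition deg (G : sgraph) (x : G) : nat := #|[set y | adj x y]|.

Definition locally_irregular (G : sgraph) : bool :=
  [forall x : G, forall y : G, adj x y ==> (deg x != deg y)].

Section ColorClass.

Variables (G : sgraph) (C : finType) (c : {ffun edge G -> C}) (a : C).

Definition color_adj : rel G :=
  fun x y => [exists f : edge G, (val f == [set x; y]) && (c f == a)].

Lemma color_adj_sym : symmetric color_adj.
Proof. by move=> x y; rewrite /color_adj setUC. Qed.

Lemma color_adj_irrefl : irreflexive color_adj.
Proof.
move=> x; apply/negbTE/negP => /existsP [[f fE] /= /andP[/eqP fx _]].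
case/imsetP: fE => -[y z]; rewrite inE /= => yz fyz.
have : y \in [set x; x] by rewrite -fx fyz !inE eqxx.
have : z \in [set x; x] by rewrite -fx fyz !inE eqxx orbT.
rewrite !inE !orbb => /eqP zx /eqP yx.
by move: yz; rewrite zx yx adj_irrefl.
Qed.

(* Keeps every vertex of G; a vertex incident with no edge of color a is
   isolated here and so does not affect local irregularity. *)
Definition color_class : sgraph := SGraph color_adj_sym color_adj_irrefl.

End ColorClass.

Definition li_coloring (G : sgraph) (C : finType) (c : {ffun edge G -> C}) :
    bool :=
  [forall a : C, locally_irregular (color_class c a)].

(* Colors need not all be used, so this means "with at most k colors"; an
   edgeless graph is colorable with k = 0. *)
Definition li_colorable (G : sgraph) (k : nat) : bool :=
  [exists c : {ffun edge G -> 'I_k}, li_coloring c].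

Definition decomposable (G : sgraph) : Prop := exists k : nat, li_colorable G k.

Definition chi_irr (G : sgraph) (decG : decomposable G) : nat := ex_minn decG.

(* Main.v *)
Require Import Defs.
From mathcomp Require Import all_boot.
From mathcomp Require Import zify.

(* Call a set of edges even orientable if it has an orientation with all outdegrees even.

   Removing one locally irregular subgraph H from a decomposable graph leaves an even orientable
   graph P: every odd component of a color class of a given locally irregular coloring is the union
   of an even orientable graph and of a small odd star or spider, two such pieces that meet form an
   even orientable graph together, and disjoint pieces form a locally irregular graph.

   Let T be a spanning forest of P. A locally optimal partition of the vertices of P - T into two
   sides, and of each side into 72 classes, leaves every vertex with 72 times more neighbors on the
   other side than in its class. By a theorem of Addario-Berry, Dalal and Reed on subgraphs with two
   prescribed degree options at every vertex, there is then a locally irregular graph R that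
   contains all edges inside the classes. A 3-star in each component that contains an odd number of
   edges of R repairs the parity. What remains is the union of two even orientable graphs, properly
   colored with 144 and with 4 labels: the forest T was set aside so that one edge for every odd
   component can be moved to the second graph.

   Finally, in an even orientable graph the edges are paired at their tails into cherries, and by
   cover-free families of label sets the cherries are split into bipartite graphs whose cherries
   all have their center on the same side, so the degrees on that side are even in every coloring of
   the cherries. A coloring of the cherries with all color degrees odd or zero on the other side is
   an odd edge coloring of a multigraph; seven colors suffice. *)

Set Implicit Arguments.
Unset Strict Implicit.
Unset Printing Implicit Defensive.

(** * Shortest-path ranks in a finite relation *)

Section Bfs.

Variables (V : finType) (r : rel V).

(** The rank is the length of a shortest path from [x0]; the vertex before [y] on such a path is the
    required [x]. *)
Lemma bfs_rank (x0 : V) : exists rk : V -> nat,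
  rk x0 = 0 /\ forall y, connect r x0 y -> y != x0 ->
    exists2 x, connect r x0 x & r x y /\ rk y = (rk x).+1.
Proof.
pose reach y n := [exists p : n.-tuple V, path r x0 p && (y == last x0 p)].
have reachP y n : reflect (exists p, [/\ path r x0 p, y = last x0 p & size p = n])
    (reach y n).
  apply: (iffP existsP) => [[p /andP[pp /eqP yl]]|[p [pp yl szp]]].
    by exists p; split=> //; rewrite size_tuple.
  have/eqP szp' := szp.
  by exists (Tuple szp'); rewrite /= pp yl eqxx.
(* The second disjunct makes the minimum exist at unreachable vertices as well. *)
have ex y : exists n, reach y n || ~~ connect r x0 y.
  case c: (connect r x0 y); last by exists 0; rewrite orbT.
  case/connectP: c => p pp yl; exists (size p); apply/orP; left.
  by apply/reachP; exists p.
exists (fun y => ex_minn (ex y)); split.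
  case: ex_minnP => n _ minn; apply/eqP; rewrite -leqn0; apply: minn.
  by apply/orP; left; apply/reachP; exists [::].
move=> y cy ny.
case: (ex_minnP (ex y)) => n; rewrite cy orbF => /reachP [p [pp yl szp]] minn.
case/lastP: p pp yl szp => [|p z]; first by move=> _ /= yx; rewrite yx eqxx in ny.
rewrite rcons_path last_rcons size_rcons => /andP[pp rz] yz szp; subst z.
set x := last x0 p in rz *.
have cx : connect r x0 x by apply/connectP; exists p.
exists x => //; split=> //.
case: ex_minnP => m; rewrite cx orbF => /reachP [q [pq xq szq]] minm.
have le1 : m <= size p by apply: minm; apply/orP; left; apply/reachP; exists p.
have le2 : n <= m.+1.
  apply: minn; rewrite orbF; apply/reachP; exists (rcons q y).
  by rewrite rcons_path last_rcons size_rcons szq pq -xq.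
by apply/eqP; rewrite eqn_leq le2 /=; rewrite -szp ltnS.
Qed.

End Bfs.

(** * Counting modulo 2 *)

Section Parity.

Lemma odd_bigsum (I : finType) (P : pred I) (F : I -> nat) :
  odd (\sum_(i | P i) F i) = odd #|[set i | P i && odd (F i)]|.
Proof.
rewrite -sum1_card big_mkcond [in RHS]big_mkcond /=.
rewrite !(big_morph odd oddD (erefl _)).
by apply: eq_bigr => i _; rewrite inE; case: (P i); case: (odd (F i)).
Qed.

Lemma card_partition_sum (I J : finType) (A : {set I}) (f : I -> J) (P : pred J) :
  #|[set i in A | P (f i)]| = \sum_(j | P j) #|[set i in A | f i == j]|.
Proof.
rewrite -sum1_card (partition_big f P) /=; last by move=> i; rewrite inE => /andP[].
apply: eq_bigr => j Pj; rewrite -sum1_card; apply: eq_bigl => i.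
by rewrite !inE -andbA; case: eqP => [->|]; rewrite ?Pj ?andbF ?andbT.
Qed.

Lemma odd_cardX (I : finType) (A : {set I}) (p q : pred I) :
  odd #|[set i in A | p i (+) q i]| =
  odd #|[set i in A | p i]| (+) odd #|[set i in A | q i]|.
Proof.
rewrite -!sum1_card ![\sum_(i in _) 1]big_mkcond !(big_morph odd oddD (erefl _)) -big_split.
by apply: eq_bigr => i _; rewrite !inE; case: (i \in A); case: (p i); case: (q i).
Qed.

End Parity.

(** * Multigraphs, spanning forests and orientations *)

Section Multigraph.

Variables (V E : finType) (src tgt : E -> V).

Definition inc (v : V) (e : E) : bool := (v == src e) || (v == tgt e).
Definition other (v : V) (e : E) : V := if v == src e then tgt e else src e.
Definition edeg (W : {set E}) (v : V) : nat := #|[set e in W | inc v e]|.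
(** An orientation is encoded as a map [o] from edges to their tails; [inc (o e) e] is assumed
    separately. *)
Definition outdeg (W : {set E}) (o : E -> V) (v : V) : nat :=
  #|[set e in W | o e == v]|.
Definition loopless (W : {set E}) : Prop := {in W, forall e, src e != tgt e}.

Lemma inc_src e : inc (src e) e. Proof. by rewrite /inc eqxx. Qed.
Lemma inc_tgt e : inc (tgt e) e. Proof. by rewrite /inc eqxx orbT. Qed.
Lemma inc_other v e : inc (other v e) e.
Proof. by rewrite /other; case: ifP; rewrite (inc_src, inc_tgt). Qed.

Lemma other_neq v e : src e != tgt e -> inc v e -> other v e != v.
Proof.
rewrite /inc /other => ne; case: (v =P src e) => [-> _|_ /= /eqP->//].
by rewrite eq_sym.
Qed.

Lemma incE v u e : inc v e -> inc u e = (u == v) || (u == other v e).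
Proof.
by rewrite /inc /other; case: (v =P src e) => [->//|_ /= /eqP ->]; rewrite orbC.
Qed.

Lemma other_eq v u e : inc v e -> inc u e -> u != v -> u = other v e.
Proof. by move=> iv; rewrite (incE u iv) => /orP[->//|/eqP->]. Qed.

Lemma sum_edeg (W : {set E}) (r : pred V) :
  loopless W -> \sum_(v | r v) edeg W v =
  #|[set e in W | r (src e)]| + #|[set e in W | r (tgt e)]|.
Proof.
move=> ll; rewrite (card_partition_sum W src r) (card_partition_sum W tgt r).
rewrite -big_split; apply: eq_bigr => x _ /=; rewrite /edeg.
have -> : [set e in W | inc x e] =
    [set e in W | src e == x] :|: [set e in W | tgt e == x].
  by apply/setP => e; rewrite !inE /inc -andb_orr ![x == _]eq_sym.
rewrite cardsU (_ : _ :&: _ = set0) ?cards0 ?subn0 //.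
apply/setP => e; rewrite !inE.
apply/negbTE/negP => /andP[/andP[eW /eqP <-] /andP[_ /eqP te]].
by have := ll _ eW; rewrite te eqxx.
Qed.

Definition flip (F : {set E}) (o : E -> V) (e : E) : V :=
  if e \in F then other (o e) e else o e.

Lemma flip_inc (F : {set E}) o e : (e \in F = false -> inc (o e) e) -> inc (flip F o e) e.
Proof. by rewrite /flip; case: ifP => [_ _|_ ->//]; rewrite inc_other. Qed.

(** Reversing one edge changes the outdegree by one at each of its two ends. *)
Lemma odd_outdeg_flip (W F : {set E}) (o : E -> V) v :
  loopless W -> F \subset W -> {in W, forall e, inc (o e) e} ->
  odd (outdeg W (flip F o) v) = odd (outdeg W o v) (+) odd (edeg F v).
Proof.
move=> ll /subsetP sF io.
have -> : edeg F v = #|[set e in W | (e \in F) && inc v e]|.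
  apply: eq_card => e; rewrite !inE andbA; congr (_ && _).
  by case eF: (e \in F); rewrite ?andbF // andbT (sF _ eF).
rewrite -odd_cardX; congr (odd _); apply: eq_card => e; rewrite !inE.
case eW: (e \in W) => //=; have ie := io _ eW; have ne := other_neq (ll _ eW) ie.
rewrite /flip; case: (e \in F) => /=; last by rewrite addbF.
rewrite (incE v ie) ![v == _]eq_sym.
by case: (o e =P v) => [<-|_] /=; rewrite ?(negbTE ne) //; case: eqP.
Qed.

(** A spanning forest of [W] given by parent edges: [pe v] leads from a non-root [v] one step closer
    to its root. [root] names the components of all of [W], and [pe] is arbitrary at roots. *)
Record forest (W : {set E}) (root : V -> V) (rk : V -> nat) (pe : V -> E) : Prop := Forest {
  forest_edge : {in W, forall e, root (src e) = root (tgt e)};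
  forest_idem : forall v, root (root v) = root v;
  forest_pe : forall v, root v != v ->
    [/\ pe v \in W, inc v (pe v), root (other v (pe v)) = root v
      & rk v = (rk (other v (pe v))).+1] }.

(** Breadth-first trees from one representative per component; [e0] is the default value of [pe] at
    roots. *)
Lemma forest_exists (e0 : E) (W : {set E}) : exists root rk pe, forest W root rk pe.
Proof.
pose adj x y := [exists e in W, inc x e && inc y e].
have sadj : symmetric adj.
  by move=> x y; apply: eq_existsb => e; rewrite [inc x e && _]andbC.
have csym : connect_sym adj by apply: sym_connect_sym.
have [rk rkP] := fin_all_exists (bfs_rank adj).
pose peP v e := root adj v != v ->
  [/\ e \in W, inc v e, root adj (other v e) = root adj v
    & rk (root adj v) v = (rk (root adj v) (other v e)).+1].
have [pe pePe] : exists pe, forall v, peP v (pe v).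
  apply: (@fin_all_exists V (fun=> E) peP) => v.
  case: (boolP (root adj v == v)) => [rv|rv]; first by exists e0; rewrite /peP rv.
  have [_ /(_ v)[]] := rkP (root adj v).
  - by rewrite csym connect_root.
  - by rewrite eq_sym.
  move=> x cx [/existsP[e /and3P[eW xe ve]] rke]; exists e => _.
  have xv : x != v by apply/eqP => xv; move: rke; rewrite xv; lia.
  rewrite -(other_eq ve xe xv); split=> //.
  apply/esym/eqP; rewrite root_connect //.
  by apply: connect_trans cx; apply: connect_root.
exists (root adj), (fun v => rk (root adj v) v), pe; split=> //.
- move=> e eW; apply/eqP; rewrite root_connect //; apply: connect1.
  by apply/existsP; exists e; rewrite eW inc_src inc_tgt.
- by move=> v; rewrite root_root.
- by move=> v rv; have [? ? er ?] := pePe v rv; split=> //; rewrite er.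
Qed.

Section ForestTheory.

Variables (W : {set E}) (root : V -> V) (rk : V -> nat) (pe : V -> E).
Hypotheses (fo : forest W root rk pe) (ll : loopless W).

Definition par (v : V) : V := other v (pe v).

Lemma par_neq v : root v != v -> par v != v.
Proof. by case/(forest_pe fo) => eW iv _ _; apply: other_neq (ll eW) iv. Qed.

Lemma forest_inc e v : e \in W -> inc v e -> root v = root (src e).
Proof. by move=> eW /orP[] /eqP -> //; rewrite (forest_edge fo eW). Qed.

(** Two vertices with the same parent edge would be parents of each other, and each rank would
    exceed the other. *)
Lemma pe_inj : {in [pred v | root v != v] &, injective pe}.
Proof.
move=> u v; rewrite !inE => ru rv euv; apply/eqP/negPn/negP => nuv.
have [_ iu _ ku] := forest_pe fo ru; have [_ iv _ kv] := forest_pe fo rv.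
have ou : v = other u (pe u) by apply: other_eq => //; rewrite ?euv // eq_sym.
have ov : u = other v (pe v) by apply: other_eq => //; rewrite -?euv.
by move: ku kv; rewrite -ou -ov; lia.
Qed.

(* An edge of the forest meets its lower endpoint u and the parent of u only. *)
Lemma edeg_pe (J : {set V}) v : {in J, forall u, root u != u} ->
  edeg (pe @: J) v = (v \in J) + #|[set u in J | par u == v]|.
Proof.
move=> nr; rewrite /edeg.
have -> : [set e in pe @: J | inc v e] = pe @: [set u in J | inc v (pe u)].
  apply/setP => e; rewrite inE; apply/andP/imsetP => [[/imsetP[u uJ ->] iu]|[u]].
    by exists u; rewrite // inE uJ.
  by rewrite inE => /andP[uJ iu] ->; split=> //; apply: imset_f.
rewrite card_in_imset; last first.
  move=> x y; rewrite !inE => /andP[xJ _] /andP[yJ _]; apply: pe_inj; rewrite inE; exact: nr.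
have -> : [set u in J | inc v (pe u)] =
    [set u in J | u == v] :|: [set u in J | par u == v].
  apply/setP => u; rewrite !inE -andb_orr; case uJ: (u \in J) => //=.
  have [_ iu _ _] := forest_pe fo (nr _ uJ).
  by rewrite (incE v iu) -/(par u) ![v == _]eq_sym.
rewrite cardsU (_ : _ :&: _ = set0) ?cards0 ?subn0; last first.
  apply/setP => u; rewrite !inE; apply/negbTE/negP => /andP[/andP[uJ /eqP->]].
  by case/andP=> vJ; rewrite (negbTE (par_neq (nr _ vJ))).
congr (_ + _); case vJ: (v \in J).
  rewrite /nat_of_bool -(cards1 v); apply: eq_card => u; rewrite !inE.
  by case: eqP => [->|]; rewrite ?vJ ?andbF.
by apply/eqP; rewrite cards_eq0; apply/eqP/setP => u; rewrite !inE; case: eqP => [->|];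
  rewrite ?vJ ?andbF.
Qed.

(** The parent edges are chosen from the deepest vertices upwards. Once the children of [v] are
    decided, the prescribed parity at [v] decides its own parent edge. *)
Lemma tree_join (N : pred V) (t : V -> bool) :
  (forall v, N v -> root v != v) ->
  exists J : {set V}, {in J, forall v, N v} /\
    forall v, N v -> odd (edeg (pe @: J) v) = t v.
Proof.
move=> Nnr; pose m := \max_v rk v.
have rkm v : rk v <= m by apply: leq_bigmax.
suff [J [JN JP]] : exists J : {set V}, {in J, forall v, N v} /\
    forall v, N v -> m.+1 <= m.+1 + rk v ->
      odd ((v \in J) + #|[set u in J | par u == v]|) = t v.
  exists J; split=> // v Nv; rewrite edeg_pe ?JP ?leq_addr //.
  by move=> u /JN/Nnr.
elim: {2}m.+1 => [|k [J [JN JP]]].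
  exists set0; split=> [v|v _]; first by rewrite inE.
  by have := rkm v; lia.
pose ch v := [set u in J | par u == v].
(* Only the level of rank [m - k] is decided here; the children of its vertices lie one level deeper
   and stay as they are. *)
pose J' := [set v | if k + rk v == m then N v && (odd #|ch v| != t v) else v \in J].
have chE v : N v -> m <= k + rk v -> [set u in J' | par u == v] = ch v.
  move=> Nv kv; apply/setP => u; rewrite !inE.
  case: (par u =P v) => [uv|_]; rewrite ?andbF // !andbT.
  case: eqP => // ku; apply/andP/idP => [[Nu _]|uJ].
    have [_ _ _] := forest_pe fo (Nnr _ Nu); rewrite -/(par u) uv; lia.
  have Nu := JN _ uJ; have [_ _ _] := forest_pe fo (Nnr _ Nu); rewrite -/(par u) uv; lia.
exists J'; split=> [v|v Nv]; first by rewrite inE; case: ifP => [_ /andP[]//|_ /JN].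
rewrite addSn ltnS => kv; rewrite chE // inE; case: eqP => [kr|kr].
  by rewrite Nv /= oddD oddb; case: (odd #|ch v|); case: (t v).
by rewrite JP //; lia.
Qed.

(** Each edge is counted at its tail, which lies in the same component. *)
Lemma odd_outdeg_comp (W' : {set E}) (o : E -> V) r : W' \subset W ->
  {in W', forall e, inc (o e) e} ->
  odd #|[set e in W' | root (src e) == r]| =
  odd #|[set v | (root v == r) && odd (outdeg W' o v)]|.
Proof.
move=> sW io; rewrite -odd_bigsum -card_partition_sum; congr (odd _).
apply: eq_card => e; rewrite !inE; case eW: (e \in W') => //=.
by rewrite (forest_inc (subsetP sW _ eW) (io _ eW)).
Qed.

(** Starting from the orientation by [src], the edges of a suitable forest join are reversed to
    correct the parities on [N]. *)
Lemma orientation (N : pred V) (W' : {set E}) (t : V -> bool) :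
  W' \subset W -> (forall v, N v -> root v != v /\ pe v \in W') ->
  exists o : E -> V, (forall e, inc (o e) e) /\
    forall v, N v -> odd (outdeg W' o v) = t v.
Proof.
move=> sW Nnr.
have [J [JN JP]] : exists J : {set V}, {in J, forall v, N v} /\
    forall v, N v -> odd (edeg (pe @: J) v) = t v (+) odd (outdeg W' src v).
  by apply: tree_join => v /Nnr[].
exists (flip (pe @: J) src); split=> [e|v Nv].
  by apply: flip_inc => ?; rewrite inc_src.
have ll' : loopless W' by move=> e eW; apply: ll; apply: (subsetP sW).
have sJ : pe @: J \subset W' by apply/subsetP => e /imsetP[u /JN/Nnr[_ ?] ->].
rewrite odd_outdeg_flip ?JP // => [|e _]; last exact: inc_src.
by case: (t v); case: (odd _).
Qed.

End ForestTheory.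

End Multigraph.

(** * Subgraphs of bipartite graphs with two degree options at each vertex *)

Section MoreDegrees.

Variables (V E : finType) (src tgt : E -> V).
Local Notation edeg := (edeg src tgt).
Local Notation inc := (inc src tgt).

Lemma edegU (F H : {set E}) v : [disjoint F & H] ->
  edeg (F :|: H) v = edeg F v + edeg H v.
Proof.
move=> dj; rewrite /edeg -cardsUI (_ : _ :&: _ = set0) ?cards0 ?addn0.
  by apply: eq_card => e; rewrite !inE andb_orl.
apply/setP => e; rewrite !inE; apply/negbTE/negP => /andP[/andP[eF _] /andP[eH _]].
by have /pred0P/(_ e) := dj; rewrite /= eF eH.
Qed.

Lemma edegD (F H : {set E}) v : F \subset H -> edeg H v = edeg F v + edeg (H :\: F) v.
Proof.
move=> /subsetP sF; rewrite /edeg -(cardsID F); congr (_ + _); apply: eq_card => e.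
  by rewrite !inE; case eF: (e \in F); rewrite ?andbF ?andbT //= sF.
by rewrite !inE andbA.
Qed.

Lemma edeg1 e v : edeg [set e] v = inc v e.
Proof.
rewrite /edeg; case iv: (inc v e).
  rewrite /nat_of_bool -(cards1 e); apply: eq_card => x; rewrite !inE.
  by case: eqP => [->|]; rewrite ?iv.
apply/eqP; rewrite cards_eq0; apply/eqP/setP => x; rewrite !inE.
by case: eqP => [->|]; rewrite ?iv.
Qed.

Lemma edegS (F H : {set E}) v : F \subset H -> edeg F v <= edeg H v.
Proof.
move=> /subsetP sF; apply: subset_leq_card; apply/subsetP => e.
by rewrite !inE => /andP[/sF -> ->].
Qed.

Lemma inc_sides (s : V -> bool) e u v : s (src e) != s (tgt e) ->
  inc u e -> inc v e -> s u = s v -> u = v.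
Proof.
move=> ne /orP[] /eqP-> /orP[] /eqP-> // eqs; first by rewrite eqs eqxx in ne.
by rewrite eqs eqxx in ne.
Qed.

Definition simple_edges : Prop := forall e f u v, u != v ->
  inc u e -> inc v e -> inc u f -> inc v f -> e = f.

Lemma edeg_star (K : {set E}) y v : simple_edges -> v != y ->
  {in K, forall e, inc y e} -> edeg K v <= 1.
Proof.
move=> simp vy iy; rewrite leqNgt; apply/negP => /card_gt1P[e [f []]].
rewrite !inE => /andP[eK ve] /andP[fK vf]; apply/negP/negPn/eqP.
by apply: (simp _ _ v y) => //; apply: iy.
Qed.

End MoreDegrees.

Lemma exists_subset_card (T : finType) (A : {set T}) k : k <= #|A| ->
  exists2 B : {set T}, B \subset A & #|B| = k.
Proof.
move=> kA; exists [set x in take k (enum A)].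
  by apply/subsetP => x; rewrite inE => /mem_take; rewrite mem_enum.
rewrite cardsE; have /card_uniqP -> : uniq (take k (enum A)) by rewrite take_uniq ?enum_uniq.
by rewrite size_takel // -cardE.
Qed.

Section DegreeConstrained.

Variables (V E : finType) (src tgt : E -> V).
Local Notation edeg := (edeg src tgt).
Local Notation inc := (inc src tgt).
Hypothesis simp : simple_edges src tgt.
Variables (s : V -> bool) (P : {set E}).
Hypothesis bip : {in P, forall e, s (src e) != s (tgt e)}.
Variables lo hi : V -> nat.
Hypothesis lo_half : forall v, lo v * 2 <= edeg P v.
Hypothesis hi_half : forall v, edeg P v <= hi v * 2 + 2.
Hypothesis lo_hi : forall v, lo v <= hi v.
Hypothesis hi_lo : forall v, hi v <= lo v * 2 + 3.
Hypothesis hi_top : forall v, hi v * 2 <= edeg P v + lo v + 2.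

(** [b] is the set of vertices that aim at their high option. A valid [H] exceeds its aim by at most
    one, so where nothing is lacking the degree is one of the four allowed values. *)
Definition cap (b : {set V}) v := if v \in b then hi v else lo v.
Definition valid (H : {set E}) (b : {set V}) :=
  (H \subset P) && [forall v, edeg H v <= (cap b v).+1].
Definition lack (H : {set E}) (b : {set V}) v := cap b v - edeg H v.

Section Optimal.

Variables (H : {set E}) (b : {set V}) (v0 : V).
Hypothesis vHb : valid H b.
Hypothesis opt : forall H' b', valid H' b' ->
  (forall v, lack H' b' v <= lack H b v) -> lack H' b' v0 < lack H b v0 -> False.
Hypothesis lack0 : edeg H v0 < cap b v0.

Let sHP : {subset H <= P}.
Proof. by apply/subsetP; case/andP: vHb. Qed.
Let capH v : edeg H v <= (cap b v).+1.
Proof. by case/andP: vHb => _ /forallP. Qed.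

(* Steps of alternating walks that leave v0 along an edge outside H. Below, A and B are the sets of
   vertices that such walks reach on the side of v0 and on the other side. *)
Definition alt (u w : V) :=
  [exists e in P, [&& inc u e, inc w e, u != w & (e \in H) == (s u != s v0)]].
Local Notation reach := (connect alt v0).

Lemma alt_side e u w : e \in P -> inc u e -> inc w e -> u != w -> s u = ~~ s w.
Proof.
move=> eP iu iw uw; case: (boolP (s u == s w)) => [/eqP eqs|].
  by rewrite (inc_sides (bip eP) iu iw eqs) eqxx in uw.
by case: (s u); case: (s w).
Qed.

(** [H] is switched along a shortest alternating walk to [z]. Degrees change only at the ends: [v0]
    gains one edge, and [z] loses or gains one according to its side. That at most one edge at [z]
    changes leaves the others free for a further modification. *)
Lemma alternate_flip z : reach z -> exists H' : {set E},
  [/\ H' \subset P,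
      forall v, edeg H' v + (if s z == s v0 then v == z else false) =
                edeg H v + (v == v0) + (if s z == s v0 then false else v == z)
    & #|[set e | inc z e && ((e \in H') != (e \in H))]| <= (z != v0)].
Proof.
have [rk [rk0 rkP]] := bfs_rank alt v0.
(* The induction also carries that switched edges meet only vertices of rank at most [rk z], so all
   edges at the next vertex are still as in [H]. *)
move=> cz; suff : exists H' : {set E},
  [/\ H' \subset P,
      forall v, edeg H' v + (if s z == s v0 then v == z else false) =
                edeg H v + (v == v0) + (if s z == s v0 then false else v == z),
      forall e v, (e \in H') != (e \in H) -> inc v e -> rk v <= rk z
    & #|[set e | inc z e && ((e \in H') != (e \in H))]| <= (z != v0)].
  by case=> H' [? ? _ ?]; exists H'.
elim: {z}(rk z) {-2}z (erefl (rk z)) cz => [|n IH] z rz cz.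
  have -> : z = v0 by apply/eqP/negPn/negP => /(rkP _ cz)[x _ []]; rewrite rz.
  exists H; split.
  - by apply/subsetP.
  - by move=> v; rewrite eqxx addn0.
  - by move=> e v; rewrite eqxx.
  - by rewrite (_ : [set e | _] = set0) ?cards0 //; apply/setP => e; rewrite !inE eqxx andbF.
have zv : z != v0 by apply/eqP => zv; move: rz; rewrite zv rk0.
have [u cu [/existsP[e /and5P[eP iu iz uz /eqP eH]] rzu]] := rkP _ cz zv.
have rzu1 : rk u = n by move: rz rzu; clear; lia.
have [H1 [sH1 dH1 nearH1 _]] := IH u rzu1 cu.
have su := alt_side eP iu iz uz.
have farz f : inc z f -> (f \in H1) = (f \in H).
  move=> izf; apply/eqP/negPn/negP => nf; have := nearH1 _ _ nf izf; by rewrite rzu ltnn.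
have eH1 := farz _ iz.
have ince v : inc v e = (v == u) || (v == z).
  by rewrite (incE v iu) (other_eq iu iz) // eq_sym.
pose H' := if e \in H then H1 :\ e else e |: H1.
have memH' f : f != e -> (f \in H') = (f \in H1).
  by rewrite /H' => fe; case: ifP; rewrite !inE ?fe // (negbTE fe).
exists H'; split.
- by rewrite /H'; case: ifP => _; [apply: subset_trans sH1; apply: subsetDl | rewrite subUset sub1set eP].
- move=> v; have := dH1 v; rewrite /H' eH; case: (boolP (s u == s v0)) => su0 /=.
    have -> : s z == s v0 = false by move: su su0; case: (s u); case: (s z); case: (s v0).
    rewrite edegU ?disjoints1 ?eH1 ?eH ?su0 // edeg1 ince.
    by case: (v =P u) => [->|_]; rewrite ?(negbTE uz) /=; case: (v == z); clear; lia.
  have -> : s z == s v0 by move: su su0; case: (s u); case: (s z); case: (s v0).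
  rewrite (@edegD _ _ _ _ [set e] H1) ?sub1set ?eH1 ?eH ?su0 // edeg1 ince.
  by case: (v =P u) => [->|_]; rewrite ?(negbTE uz) /=; case: (v == z); clear; lia.
- move=> f v; case: (f =P e) => [-> _|/eqP fe].
    by rewrite ince rzu => /orP[] /eqP->; rewrite ?rzu ?leqnSn.
  by rewrite memH' // => nf iv; rewrite rzu leqW // (nearH1 _ _ nf iv).
- rewrite zv /nat_of_bool -(cards1 e); apply: subset_leq_card; apply/subsetP => f.
  rewrite !inE => /andP[izf]; apply: contraR => fe.
  by rewrite memH' // farz.
Qed.


Let A := [set v | reach v && (s v == s v0)].
Let B := [set v | reach v && (s v != s v0)].
Let crossAB e := (src e \in A) && (tgt e \in B) || (src e \in B) && (tgt e \in A).
Let N := [set e in P | (e \notin H) && crossAB e].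
Let M := [set e in H | crossAB e].

Lemma opt_le H' b' : valid H' b' -> (forall v, lack H' b' v <= lack H b v) ->
  cap b v0 - edeg H v0 <= lack H' b' v0.
Proof. by move=> v' le'; rewrite leqNgt; apply/negP => lt; apply: opt v' le' lt. Qed.

Lemma crossABE u w e : inc u e -> inc w e -> u != w ->
  crossAB e = (u \in A) && (w \in B) || (u \in B) && (w \in A).
Proof.
rewrite /crossAB => /orP[] /eqP-> /orP[] /eqP->; rewrite ?eqxx // => _.
by rewrite orbC [(_ \in A) && _]andbC [(_ \in B) && _]andbC.
Qed.

Lemma loopP : {in P, forall e, src e != tgt e}.
Proof. by move=> e /bip; apply: contraNneq => ->. Qed.

Lemma reach_step u e : reach u -> e \in P -> inc u e ->
  (e \in H) = (s u != s v0) -> reach (other src tgt u e).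
Proof.
move=> cu eP iu eH; apply: connect_trans cu _; apply: connect1.
apply/existsP; exists e; rewrite eP iu inc_other eH eqxx !andbT /=.
by rewrite eq_sym other_neq // loopP.
Qed.

Lemma side_other u e : e \in P -> inc u e -> s (other src tgt u e) = ~~ s u.
Proof.
move=> eP iu; have ne := other_neq (loopP eP) iu.
by rewrite (alt_side eP (inc_other src tgt u e) iu ne).
Qed.

(** Such an edge continues an alternating walk, so its other end is in [B]. *)
Lemma stepA x e : x \in A -> e \in P -> inc x e -> e \notin H -> e \in N.
Proof.
move=> xA eP ix eH; rewrite inE eP eH /=.
have := xA; rewrite inE => /andP[cx sx].
have ne := other_neq (loopP eP) ix; rewrite eq_sym in ne.
rewrite (crossABE ix (inc_other src tgt x e) ne) xA /= inE reach_step ?(negbTE eH) ?sx //=.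
by rewrite side_other // (eqP sx) orbC; case: (s v0); rewrite ?orbT.
Qed.

Lemma stepB y e : y \in B -> inc y e -> e \in H -> e \in M.
Proof.
move=> yB iy eH; rewrite inE eH /=; have eP := sHP eH.
have := yB; rewrite inE => /andP[cy sy].
have ne := other_neq (loopP eP) iy; rewrite eq_sym in ne.
rewrite (crossABE iy (inc_other src tgt y e) ne) yB /= orbC inE reach_step ?eH ?sy //=.
by rewrite side_other //; move: sy; case: (s v0); case: (s y).
Qed.

Lemma v0A : v0 \in A. Proof. by rewrite inE connect0 eqxx. Qed.

Lemma flipB y : y \in B -> exists H' : {set E},
  [/\ H' \subset P, forall v, edeg H' v = edeg H v + (v == v0) + (v == y),
   #|[set e | inc y e && ((e \in H') != (e \in H))]| <= 1 & y != v0].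
Proof.
rewrite inE => /andP[cy sy]; have [H' [sH' dH' nH']] := alternate_flip cy.
exists H'; split=> //; last by apply: contraNneq sy => ->.
  by move=> v; have := dH' v; rewrite (negbTE sy) addn0.
exact: leq_trans nH' (leq_b1 _).
Qed.

Lemma flipA x : x \in A -> exists H' : {set E},
  [/\ H' \subset P, forall v, edeg H' v + (v == x) = edeg H v + (v == v0) &
   #|[set e | inc x e && ((e \in H') != (e \in H))]| <= (x != v0)].
Proof.
rewrite inE => /andP[cx sx]; have [H' [sH' dH' nH']] := alternate_flip cx.
by exists H'; split=> // v; have := dH' v; rewrite sx addn0.
Qed.

(** Otherwise the switch along a walk to [y] gives one more edge to both [v0] and [y] and stays
    valid, against optimality. *)
Lemma fullB y : y \in B -> edeg H y = (cap b y).+1.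
Proof.
move=> /flipB[H' [sH' dH' _ yv0]]; apply/eqP; rewrite eqn_leq capH ltnNge.
apply/negP => ly; suff : cap b v0 - edeg H v0 <= lack H' b v0.
  by move: lack0; rewrite /lack dH' eqxx; clear; lia.
apply: opt_le => [|v]; last by rewrite /lack dH'; clear; lia.
rewrite /valid sH'; apply/forallP => v; rewrite dH'; have := capH v.
case: (v =P v0) => [->|_]; first by move: lack0; rewrite eq_sym (negbTE yv0); clear; lia.
by move: ly; case: (v =P y) => [->|_]; clear; lia.
Qed.

(** Otherwise a walk would transfer the surplus edge of [x] to [v0]. *)
Lemma capA x : x \in A -> edeg H x <= cap b x.
Proof.
case: (x =P v0) => [-> _|/eqP xv0]; first exact: ltnW.
move=> /flipA[H' [sH' dH' _]]; rewrite leqNgt; apply/negP => ly.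
suff : cap b v0 - edeg H v0 <= lack H' b v0.
  by move: lack0; have := dH' v0; rewrite /lack eqxx eq_sym (negbTE xv0); clear; lia.
apply: opt_le => [|v].
  rewrite /valid sH'; apply/forallP => v; have := dH' v; have := capH v.
  by move: lack0; case: (v =P v0) => [->|_]; clear; lia.
by move: ly; have := dH' v; rewrite /lack; case: (v =P x) => [->|_]; case: (_ == v0); clear; lia.
Qed.

Lemma sNP : N \subset P. Proof. by apply/subsetP => e; rewrite inE => /andP[]. Qed.
Lemma sMH : M \subset H. Proof. by apply/subsetP => e; rewrite inE => /andP[]. Qed.

Lemma notAB v : v \in A -> v \in B -> False.
Proof. by rewrite !inE => /andP[_ ->]; rewrite andbF. Qed.

Lemma cross_otherA e x v : crossAB e -> inc x e -> x \in B -> inc v e -> v != x -> v \in A.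
Proof.
move=> ab ix xB iv vx; have := ab; rewrite (crossABE iv ix vx).
by case/orP=> [/andP[]//|/andP[_ xA]]; case: (notAB xA xB).
Qed.

Lemma cross_otherB e x v : crossAB e -> inc x e -> x \in A -> inc v e -> v != x -> v \in B.
Proof.
move=> ab ix xA iv vx; have := ab; rewrite (crossABE iv ix vx).
by case/orP=> [/andP[_ xB]|/andP[]//]; case: (notAB xA xB).
Qed.

Lemma edeg_gt0 (K : {set E}) v : 0 < edeg K v -> exists2 e, e \in K & inc v e.
Proof. by case/card_gt0P => e; rewrite inE => /andP[]; exists e. Qed.

(* A vertex of B at its low option could be switched to its high option. *)
Lemma lowB y : y \in B -> y \notin b -> lo y < hi y -> edeg N y + 2 <= hi y - lo y.
Proof.
move=> yB yb lohi; rewrite leqNgt; apply/negP => lt.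
have [H1 [sH1 dH1 nH1 yv0]] := flipB yB.
pose far := [set e in N | inc y e && ((e \in H1) == (e \in H))].
have cfar : edeg N y <= #|far| + 1.
  apply: leq_trans (leq_add (leqnn _) nH1).
  rewrite -cardsUI; apply: leq_trans (leq_addr _ _).
  apply: subset_leq_card; apply/subsetP => e; rewrite !inE => /andP[-> ->] /=.
  by case: (_ == _).
(* After the switch [y] has degree [lo y + 2], and adding [K] brings it to [hi y]. If
   [hi y = lo y + 1], the difference is truncated to 0 and the degree is [hi y + 1], which is valid
   too. *)
have [K sK cK] : exists2 K : {set E}, K \subset far & #|K| = hi y - lo y - 2.
  by apply: exists_subset_card; move: cfar lt; clear; lia.
have KN e : e \in K -> [/\ e \in P, e \notin H1, inc y e & crossAB e].
  by move/(subsetP sK); rewrite !inE => /and3P[/and3P[-> nH ->] -> /eqP->].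
have eKy : edeg K y = #|K|.
  by apply: eq_card => e; rewrite inE; apply: andb_idr => /KN[].
have eK v : v != y -> edeg K v <= (v \in A).
  move=> vy; case vA: (v \in A) => /=.
    by apply: (edeg_star simp vy) => e /KN[].
  rewrite leqNgt; apply/negP => /edeg_gt0[e /KN[_ _ iy ab] iv].
  by rewrite (cross_otherA ab iy yB iv vy) in vA.
have dj : [disjoint K & H1].
  by rewrite disjoint_subset; apply/subsetP => e /KN[]; rewrite inE.
pose b' := y |: b.
have cap' v : v != y -> cap b' v = cap b v by move=> vy; rewrite /cap !inE (negbTE vy).
have capy : cap b' y = hi y by rewrite /cap !inE eqxx.
have fy := fullB yB; rewrite /cap (negbTE yb) in fy.
suff : cap b v0 - edeg H v0 <= lack (K :|: H1) b' v0.
  by move: lack0; rewrite /lack edegU // dH1 eqxx cap' 1?eq_sym //; clear; lia.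
apply: opt_le => [|v].
  rewrite /valid subUset sH1 andbT; apply/andP; split.
    by apply/subsetP => e /KN[].
  apply/forallP => v; rewrite edegU // dH1; case: (v =P y) => [->|/eqP vy].
    by move: lohi; rewrite capy eKy cK fy (negbTE yv0); clear; lia.
  (* Vertices of [A] have no surplus by [capA], so they can take one edge of [K]; at [v0] there is
     room for two edges. *)
  rewrite cap' //; have := eK _ vy; have := capH v; have := @capA v.
  move: lack0; case: (v =P v0) => [->|_]; first by rewrite v0A; clear; lia.
  by move=> _; case: (v \in A) => [/(_ isT)|_]; clear; lia.
rewrite /lack edegU // dH1; case: (v =P y) => [->|/eqP vy].
  by move: lohi; rewrite capy eKy cK fy (negbTE yv0); clear; lia.
by rewrite cap' //; clear; lia.
Qed.

(* Dually, a vertex of A at its high option could be switched to its low one. *)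
Lemma highA x : x \in A -> x \in b -> lo x < hi x -> edeg M x + lo x + 2 <= edeg H x.
Proof.
move=> xA xb lohi; rewrite leqNgt; apply/negP => lt.
have [H1 [sH1 dH1 nH1]] := flipA xA.
pose far := [set e in M | inc x e && ((e \in H1) == (e \in H))].
have cfar : edeg M x <= #|far| + (x != v0).
  apply: leq_trans (leq_add (leqnn _) nH1).
  rewrite -cardsUI; apply: leq_trans (leq_addr _ _).
  apply: subset_leq_card; apply/subsetP => e; rewrite !inE => /andP[-> ->] /=.
  by case: (_ == _).
have dx := dH1 x; rewrite eqxx in dx.
(* Deleting [K] lowers the degree of [x] to at most [lo x + 1], which is valid for the low
   option. *)
have [K sK cK] : exists2 K : {set E}, K \subset far & #|K| = edeg H1 x - (lo x).+1.
  by apply: exists_subset_card; move: cfar dx lt; case: (x == v0); clear; lia.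
have KM e : e \in K -> [/\ e \in H1, inc x e & crossAB e].
  by move/(subsetP sK); rewrite !inE => /and3P[/andP[eH ->] -> /eqP->].
have eKx : edeg K x = #|K|.
  by apply: eq_card => e; rewrite inE; apply: andb_idr => /KM[].
have eK v : v != x -> edeg K v <= (v \in B).
  move=> vx; case vB: (v \in B) => /=.
    by apply: (edeg_star simp vx) => e /KM[].
  rewrite leqNgt; apply/negP => /edeg_gt0[e /KM[_ ix ab] iv].
  by rewrite (cross_otherB ab ix xA iv vx) in vB.
have sKH : K \subset H1 by apply/subsetP => e /KM[].
have dK v := edegD src tgt v sKH.
pose b' := b :\ x.
have cap' v : v != x -> cap b' v = cap b v by move=> vx; rewrite /cap !inE vx.
have capx : cap b' x = lo x by rewrite /cap !inE eqxx.
have cx : cap b x = hi x by rewrite /cap xb.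
suff : cap b v0 - edeg H v0 <= lack (H1 :\: K) b' v0.
  rewrite /lack; case: (v0 =P x) => [v0x|/eqP vx].
    by move: lack0 lohi dx (dK x); rewrite v0x capx cx eqxx eKx cK; clear; lia.
  have := dK v0; have := dH1 v0; rewrite eqxx (negbTE vx).
  have := eK _ vx; rewrite cap' //; case: (boolP (v0 \in B)) => [v0B|_]; last by move: lack0; clear; lia.
  by case: (notAB v0A v0B).
apply: opt_le => [|v].
  rewrite /valid (subset_trans _ sH1) ?subsetDl //=.
  apply/forallP => v; have := dK v; have := dH1 v; case: (v =P x) => [->|/eqP vx].
    by rewrite capx eKx cK; clear; lia.
  rewrite cap' //; have := capH v; move: lack0.
  by case: (v =P v0) => [->|_]; clear; lia.
rewrite /lack; have := dK v; have := dH1 v; case: (v =P x) => [->|/eqP vx].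
  by move: lohi; rewrite capx cx eKx cK; case: (x =P v0) lack0 => [<-|_]; rewrite ?cx; clear; lia.
(* A vertex of [B] loses at most one edge to [K], and by [fullB] it had a surplus of one. *)
rewrite cap' //; have := eK _ vx; have := @fullB v.
by case: (v \in B) => [/(_ isT)|_]; case: (v == v0); clear; lia.
Qed.

Lemma sum_side (F : {set E}) (Z : {set V}) : F \subset P ->
  {in F, forall e, (src e \in Z) (+) (tgt e \in Z)} -> \sum_(v in Z) edeg F v = #|F|.
Proof.
move=> sFP xF; rewrite sum_edeg; last first.
  by move=> e eF; apply: loopP; apply: (subsetP sFP).
rewrite -[RHS](cardsID [set e | src e \in Z]); congr (_ + _).
  by apply: eq_card => e; rewrite !inE.
apply: eq_card => e; rewrite !inE andbC; case eF: (e \in F); rewrite ?andbF // !andbT.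
by have := xF _ eF; case: (src e \in Z); case: (tgt e \in Z).
Qed.

Lemma crossA e : crossAB e -> (src e \in A) (+) (tgt e \in A).
Proof.
case/orP=> /andP[h1 h2].
  by rewrite h1; case tA: (tgt e \in A) => //; case: (notAB tA h2).
by rewrite h2; case tA: (src e \in A) => //; case: (notAB tA h1).
Qed.

Lemma crossB e : crossAB e -> (src e \in B) (+) (tgt e \in B).
Proof.
case/orP=> /andP[h1 h2].
  by rewrite h2; case tA: (src e \in B) => //; case: (notAB h1 tA).
by rewrite h1; case tA: (tgt e \in B) => //; case: (notAB h2 tA).
Qed.

(* More edges between A and B are outside H than in H when counted from A, fewer when counted
   from B. *)
Lemma no_lack : False.
Proof.
have sMP : M \subset P by apply: subset_trans sMH _; apply/subsetP.
have abN e : e \in N -> crossAB e by rewrite inE => /and3P[].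
have abM e : e \in M -> crossAB e by rewrite inE => /andP[].
have dPH v := edegD src tgt v (introT subsetP sHP).
have eNA x : x \in A -> edeg N x = edeg (P :\: H) x.
  move=> xA; apply: eq_card => e; apply/idP/idP; rewrite !inE.
    by move=> /andP[/and3P[-> -> _] ->].
  case/andP=> /andP[eH eP] ix; rewrite ix andbT.
  by have := stepA xA eP ix eH; rewrite inE.
have eMB y : y \in B -> edeg M y = edeg H y.
  move=> yB; apply: eq_card => e; apply/idP/idP; rewrite !inE.
    by move=> /andP[/andP[-> _] ->].
  by case/andP=> eH iy; rewrite iy andbT; have := stepB yB iy eH; rewrite inE.
have sMH' x := @edegS _ _ src tgt M H x sMH.
have sNPH x : edeg N x <= edeg (P :\: H) x.
  by apply: edegS; apply/subsetP => e; rewrite !inE => /and3P[-> -> _].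
(* At the low option [lo_half] suffices; at the high option [highA] is combined with [hi_top]. The
   inequality is strict at [v0] because of [lack0]. *)
have ltA x : x \in A -> edeg M x + (x == v0) <= edeg N x.
  move=> xA; rewrite eNA //.
  have := dPH x; have := sMH' x; have := capA xA; have := lo_half x; have := lo_hi x.
  have := hi_top x; have := @highA x xA; rewrite /cap.
  case: (x =P v0) lack0 => [<-|_]; rewrite /cap; case: (x \in b); clear; try lia;
    case: (ltnP (lo x) (hi x)); lia.
(* At the high option [hi_half] bounds the edges outside [H]; at the low option [lowB] and [hi_lo]
   do. *)
have leB y : y \in B -> edeg N y <= edeg M y.
  move=> yB; rewrite eMB //; have := dPH y; have := sNPH y; have := fullB yB.
  have := hi_lo y; have := hi_half y; have := lo_hi y; have := @lowB y yB; rewrite /cap.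
  case: (boolP (y \in b)) => yb /=; clear; try lia; case: (ltnP (lo y) (hi y)); lia.
have : #|M| < #|N|.
  rewrite -(sum_side sMP (fun e eM => crossA (abM e eM))).
  rewrite -(sum_side sNP (fun e eN => crossA (abN e eN))).
  rewrite (bigD1 v0) ?v0A // [ltnRHS](bigD1 v0) ?v0A //= -addSn leq_add //.
    by have := ltA _ v0A; rewrite eqxx addn1.
  by apply: leq_sum => x /andP[xA _]; apply: leq_trans (ltA _ xA); rewrite leq_addr.
rewrite ltnNge => /negP; apply.
rewrite -(sum_side sMP (fun e eM => crossB (abM e eM))).
rewrite -(sum_side sNP (fun e eN => crossB (abN e eN))).
exact: leq_sum.
Qed.

End Optimal.

(** A valid pair with minimal total lack has no lack anywhere, by [no_lack]. *)
Theorem degree_constrained : exists R : {set E}, R \subset P /\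
  forall v, edeg R v \in [:: lo v; (lo v).+1; hi v; (hi v).+1].
Proof.
pose st := ({set E} * {set V})%type.
have v0 : valid (set0, set0 : {set V}).1 set0.
  rewrite /valid sub0set; apply/forallP => v.
  by rewrite /edeg (_ : [set e in _ | _] = set0) ?cards0 //; apply/setP => e; rewrite !inE.
pose x0 : st := (set0, set0).
have vx0 : valid x0.1 x0.2 by [].
case: (@arg_minnP _ x0 (fun x : st => valid x.1 x.2) (fun x => \sum_v lack x.1 x.2 v) vx0).
move=> [H b] /= vHb opt; exists H; split; first by case/andP: vHb.
move=> v; have := vHb => /andP[_ /forallP/(_ v)].
case: (ltnP (edeg H v) (cap b v)) => [lt|ge le].
  case: (@no_lack H b v) => // H' b' vH' le' ltv.
  have := opt (H', b') vH'; rewrite leqNgt => /negP; apply => /=.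
  rewrite (bigD1 v) // [ltnRHS](bigD1 v) //= -addSn leq_add //.
  exact: leq_sum.
by rewrite !inE; move: ge le; rewrite /cap; case: ifP => _; clear; lia.
Qed.

End DegreeConstrained.

(** * Odd edge colorings of multigraphs *)

Definition oddz (n : nat) : bool := (n == 0) || odd n.

(** A term that is odd or zero vanishes exactly when its parity does, so the sum may be replaced by
    the sum of parities. *)
Lemma oddz_sum (I : finType) (P : pred I) (F : I -> nat) :
  (forall i, P i -> oddz (F i)) -> oddz (\sum_(i | P i) odd (F i)) ->
  oddz (\sum_(i | P i) F i).
Proof.
move=> oF; rewrite /oddz !(big_morph odd oddD (erefl _)) => /orP[|] h.
  apply/orP; left; move: h; rewrite !sum_nat_eq0 => /forallP h.
  apply/forallP => i; apply/implyP => Pi; have := h i; rewrite Pi eqb0 => /=.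
  by have := oF _ Pi; rewrite /oddz; case: odd; rewrite ?orbF.
by apply/orP; right; move: h; under eq_bigr do rewrite oddb.
Qed.

(** This colors blocks of parallel edges of a star: a vertex of [A] has two blocks of different
    colors [a v] and [b v], a vertex of [B] has one. The sum counts the blocks of color [k] at the
    center. *)
Lemma block_colors (V : finType) (A B : {set V}) : [disjoint A & B] -> exists a b : V -> nat,
  [/\ forall v, a v < 4 /\ b v < 4, forall v, a v != b v &
    forall k, oddz (\sum_(v in A) ((a v == k) + (b v == k)) + \sum_(v in B) (a v == k))].
Proof.
move=> dAB.
have cst n m k : \sum_(v in A) ((n == k) + (m == k)) = #|A| * ((n == k) + (m == k)).
  by rewrite sum_nat_const.
have cstB n k : \sum_(v in B) (n == k) = #|B| * (n == k) by rewrite sum_nat_const.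
have [A0|[x xA]] := set_0Vmem A.
  subst A; clear cst; have [B0|[y yB]] := set_0Vmem B.
    by exists (fun=> 0), (fun=> 1); split=> // k; rewrite B0 !big_set0.
  case oB: (odd #|B|).
    exists (fun=> 0), (fun=> 1); split=> // k; rewrite big_set0 cstB.
    by case: k => [|k]; rewrite ?muln1 ?muln0 // /oddz oB orbT.
  exists (fun v => v == y : nat), (fun=> 2); split=> [v|v|k]; try by case: (v == y).
  rewrite /= big_set0 (bigD1 y) //= eqxx.
  under eq_bigr => v /andP[_ /negbTE vy] do rewrite vy.
  rewrite sum_nat_const; move: (cardsD1 y B) oB; rewrite yB.
  have -> : #|[pred v in B | v != y]| = #|B :\ y|.
    by apply: eq_card => v; rewrite !inE andbC.
  move: #|B :\ y| #|B| => m n -> /=; rewrite /oddz.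
  by case: k => [|[|k]] /=; rewrite ?muln1 ?muln0 ?addn0 ?add0n //; case: (odd m); rewrite ?orbT.
have cA := cardsD1 x A; rewrite xA in cA.
have cAx : #|[pred v in A | v != x]| = #|A :\ x|.
  by apply: eq_card => v; rewrite !inE andbC.
(* Except for [x], all of [A] uses colors 0 and 1, and all of [B] uses [c']; the colors [c] and [d]
   of [x] repair the parities. *)
pose col c d c' v := (if v == x then c else if v \in A then 0 else c',
                      if v == x then d else 1).
have colE c d c' k : \sum_(v in A) (((col c d c' v).1 == k) + ((col c d c' v).2 == k)) +
    \sum_(v in B) ((col c d c' v).1 == k) =
    (c == k) + (d == k) + #|A :\ x| * ((0 == k) + (1 == k)) + #|B| * (c' == k).
  rewrite (bigD1 x) //= eqxx; congr (_ + _ + _).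
    rewrite -cAx -sum_nat_const; apply: eq_bigr => v /andP[vA /negbTE ->].
    by rewrite vA.
  rewrite -sum_nat_const; apply: eq_bigr => v vB.
  have vA : v \in A = false.
    by apply/negP => vA; have /pred0P/(_ v) := dAB; rewrite /= vA vB.
  by rewrite /= vA; case: (v =P x) vA => // ->; rewrite xA.
suff [c [d [c' [cd k4 H]]]] : exists c d c', [/\ [&& c != d, c != 1 & d != 0],
    [&& c < 4, d < 4 & c' < 3] /\ c' != 1 & forall k,
    oddz ((c == k) + (d == k) + #|A :\ x| * ((0 == k) + (1 == k)) + #|B| * (c' == k))].
  exists (fun v => (col c d c' v).1), (fun v => (col c d c' v).2).
  split=> [v|v|k]; last by rewrite colE.
    rewrite /=; case: k4 => /and3P[? ? ?] _.
    by split; case: (v == x) => //; case: (v \in A) => //; apply: ltn_trans (_ : 3 < 4).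
  by rewrite /=; case/and3P: cd => ? ? ?; case: (v == x) => //; case: (v \in A) => //; case: k4.
(* If [#|A|] is odd, colors 0 and 1 are each used [#|A|] times on [A], and an odd [B] takes color 2.
   If [#|A|] is even, [x] moves to colors 2 and 3, or to 0 and 2 when [B] is odd and corrects color
   0. *)
exists (if odd #|A| then 0 else if odd #|B| then 0 else 2),
  (if odd #|A| then 1 else if odd #|B| then 2 else 3),
  (if odd #|A| && odd #|B| then 2 else 0).
rewrite cA add1n oddS; case oA: (odd _) => /=; case oB: (odd #|B|); split=> //;
  case=> [|[|[|[|k]]]]; rewrite /oddz /= ?muln1 ?muln0 ?addn0 ?add0n ?oddD ?oA ?oB //= ?orbT //.
Qed.

Section Star.

Variables (V E : finType) (f : E -> V) (Z : {set E}).

(* Each fiber of f is cut into one or two blocks of odd size. *)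
Lemma odd_star_coloring : exists c : E -> nat,
  [/\ forall e, c e < 4,
      forall v k, oddz #|[set e in Z | (f e == v) && (c e == k)]| &
      forall k, oddz #|[set e in Z | c e == k]|].
Proof.
pose m v := #|[set e in Z | f e == v]|.
pose A := [set v | (0 < m v) && ~~ odd (m v)]; pose B := [set v | odd (m v)].
have [|a [b [ab4 ab abP]]] := @block_colors V A B.
  by rewrite disjoint_subset; apply/subsetP => v; rewrite !inE => /andP[].
(* In a fiber of even positive size one picked edge forms the block of color [b], and the others,
   odd in number, the block of color [a]. *)
pose sp v := [pick e in [set e in Z | f e == v]].
pose special e := (f e \in A) && (sp (f e) == Some e).
pose c e := if special e then b (f e) else a (f e).
have sp1 v : v \in A -> exists2 e0, e0 \in [set e in Z | f e == v] &
    forall e, e \in [set e in Z | f e == v] -> special e = (e == e0).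
  move=> vA; have := vA; rewrite inE => /andP[/card_gt0P[e1 e1Z] _].
  have : sp v = [pick e in [set e in Z | f e == v]] by [].
  case: pickP => [e0 e0Z spv|/(_ e1)]; last by rewrite e1Z.
  exists e0 => // e; rewrite inE => /andP[_ /eqP fe].
  rewrite /special fe vA spv /= eq_sym.
  by apply/eqP/eqP => [[->]|->].
have cntE v k : #|[set e in Z | (f e == v) && (c e == k)]| =
    if v \in A then (m v).-1 * (a v == k) + (b v == k) else m v * (a v == k).
  case: ifP => vA.
    have [e0 e0Z e0P] := sp1 _ vA.
    have -> : [set e in Z | (f e == v) && (c e == k)] =
        [set e in [set e in Z | f e == v] | c e == k].
      by apply/setP => e; rewrite !inE andbA.
    rewrite -sum1_card big_mkcond /=.
    under eq_bigr => e _ do rewrite inE.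
    rewrite (bigD1 e0) //= e0Z /= /c (e0P _ e0Z) eqxx addnC.
    have fe0 : f e0 = v by move: e0Z; rewrite inE => /andP[_ /eqP].
    rewrite fe0; congr (_ + _).
    rewrite /m (cardsD1 e0) e0Z add1n /= -sum_nat_const big_mkcond [RHS]big_mkcond.
    apply: eq_bigr => e _; rewrite in_setD1; case: eqP => //= /eqP ne.
    case eZ: (e \in _) => //=; rewrite (e0P _ eZ) (negbTE ne).
    by move: eZ; rewrite inE => /andP[_ /eqP->]; case: (a v == k).
  rewrite /m -sum_nat_const -sum1_card big_mkcond [RHS]big_mkcond.
  apply: eq_bigr => e _; rewrite !inE; case: (e \in Z) => //=; case: eqP => //= fe.
  by rewrite /c /special fe vA; case: (a v == k).
have oddzv v k : oddz #|[set e in Z | (f e == v) && (c e == k)]|.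
  rewrite cntE; case: ifP => vA.
    have := ab v; move: vA; rewrite inE; case: (m v) => //= n; rewrite negbK /oddz => on.
    case: (a v =P k) => [->|_ _]; last by rewrite muln0; case: (b v == k).
    by rewrite eq_sym => /negbTE->; rewrite muln1 addn0 on orbT.
  move: vA; rewrite inE; case: (m v) => //= n; rewrite /oddz; case on: (odd n) => //= _.
  by case: (a v == k); rewrite ?muln1 ?muln0 //= on.
exists c; split=> // [e|k]; first by rewrite /c; case: ifP; case: (ab4 (f e)).
have -> : #|[set e in Z | c e == k]| = \sum_v #|[set e in Z | (f e == v) && (c e == k)]|.
  rewrite -sum1_card (partition_big f predT) //=; apply: eq_bigr => v _.
  by rewrite -sum1_card; apply: eq_bigl => e; rewrite !inE andbAC andbA.
apply: oddz_sum => // .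
suff -> : \sum_v odd #|[set e in Z | (f e == v) && (c e == k)]| =
    \sum_(v in A) ((a v == k) + (b v == k)) + \sum_(v in B) (a v == k) by [].
rewrite (bigID (mem A)) /=; congr (_ + _).
  apply: eq_bigr => v vA; rewrite cntE vA.
  have := ab v; move: vA; rewrite inE; case: (m v) => //= n; rewrite negbK => on.
  case: (a v =P k) => [->|_ _]; last by rewrite muln0; case: (b v == k).
  by rewrite eq_sym => /negbTE->; rewrite muln1 addn0 on.
rewrite big_mkcond [RHS]big_mkcond; apply: eq_bigr => v _.
rewrite cntE; case vA: (v \in A) => /=; last first.
  rewrite inE; move: vA; rewrite inE; case on: (odd (m v)) => /=.
    by case: (a v == k); rewrite ?muln1 ?muln0 ?on.
  by rewrite andbT; case: (m v) on => // n.
by move: vA; rewrite !inE => /andP[_ /negbTE ->].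
Qed.

End Star.

Section OddColoring.

Variables (V E : finType) (src tgt : E -> V).
Local Notation edeg := (edeg src tgt).
Local Notation inc := (inc src tgt).
Local Notation par := (par src tgt).

(** The edge [pe u] carries the color [c u]. Colors are fixed from the roots downwards, so at each
    vertex only the edge to the parent is colored before those to the children. *)
Lemma forest_two_coloring (P : {set E}) root rk pe (J : {set V}) :
  forest src tgt P root rk pe -> {in J, forall v, root v != v} ->
  exists c : V -> bool, forall v b, oddz (((v \in J) && (c v == b)) +
    #|[set u in J | (par pe u == v) && (c u == b)]|).
Proof.
move=> fo nr.
have rkJ u : u \in J -> rk u = (rk (par pe u)).+1 by move/nr/(forest_pe fo) => [].
suff [c cP] : exists c : V -> bool, forall v, rk v < (\max_v rk v).+1 ->
    forall b, oddz (((v \in J) && (c v == b)) + #|[set u in J | (par pe u == v) && (c u == b)]|).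
  by exists c => v; apply: cP; rewrite ltnS; apply: leq_bigmax.
elim: (\max_v rk v).+1 => [|n [c cP]]; first by exists (fun=> true).
pose ch v := [set u in J | par pe u == v].
(* An odd number of child edges gets a single color, different from that of the edge above [v] if
   there is one. An even number joins the color of the edge above or, without such an edge, splits
   into one edge and the rest. *)
pose c' u := if rk u != n.+1 then c u else
  let v := par pe u in
  if v \in J then (if odd #|ch v| then ~~ c v else c v)
  else if odd #|ch v| then true else Some u == [pick w in ch v].
exists c' => v; rewrite ltnS leq_eqVlt => /orP[/eqP rv|rv] b; last first.
  have := cP v rv b; congr (oddz (_ + _)).
    by rewrite /c' ltn_eqF // ltnW.
  apply: eq_card => u; rewrite !inE; case uJ: (u \in J) => //=.
  case: (par pe u =P v) => //= pu; rewrite /c'; have := rkJ _ uJ; rewrite pu => ->.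
  by rewrite eqSS (ltn_eqF rv).
have -> : c' v = c v by rewrite /c' rv ltn_eqF.
have cE u : u \in ch v -> c' u = if v \in J then (if odd #|ch v| then ~~ c v else c v)
    else if odd #|ch v| then true else Some u == [pick w in ch v].
  by rewrite inE => /andP[uJ /eqP pu]; rewrite /c' (rkJ _ uJ) pu rv eqxx.
have setE (p : V -> bool) : {in ch v, forall u, c' u = p u} ->
    [set u in J | (par pe u == v) && (c' u == b)] = [set u in ch v | p u == b].
  move=> cp; apply/setP => u; rewrite [LHS]inE [RHS]inE andbA.
  case uc: (u \in ch v); first by rewrite cp //; move: uc; rewrite inE => ->.
  by move: uc; rewrite inE => ->.
have constE (q : bool) : [set u in ch v | q == b] = if q == b then ch v else set0.
  by case: (q == b); apply/setP => u; rewrite !inE ?andbT ?andbF.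
case vJ: (v \in J) cE => /= cE.
  rewrite (setE (fun=> if odd #|ch v| then ~~ c v else c v) cE) constE.
  case oc: (odd #|ch v|); move: oc; clear; case: (c v); case: b => /= oc;
    by rewrite ?cards0 // /oddz /= ?add0n ?oc ?orbT.
case oc: (odd #|ch v|) cE => cE.
  rewrite (setE (fun=> true) cE) constE; move: oc; clear.
  by case: b => /= oc; rewrite ?cards0 // /oddz oc orbT.
rewrite (setE (fun u => Some u == [pick w in ch v]) cE) add0n.
case: pickP => [w wc|c0]; last first.
  rewrite (_ : [set u in _ | _] = set0) ?cards0 //.
  by apply/setP => u; rewrite [LHS]inE c0 inE.
have someE u : (Some u == Some w) = (u == w) by [].
have -> : [set u in ch v | (Some u == Some w) == b] = if b then [set w] else ch v :\ w.
  clear setE constE; case: b; apply/setP => u; rewrite in_set ?in_set1 ?in_setD1.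
    by rewrite someE eqb_id andbC; case: (u =P w) => [->|].
  by rewrite someE eqbF_neg andbC.
clear setE constE; case: b; first by rewrite cards1.
by move: oc; rewrite (cardsD1 w) wc add1n /= /oddz => /negbFE ->; rewrite orbT.
Qed.

Lemma edeg_sum_even (P : {set E}) root rk pe (W : {set E}) r :
  forest src tgt P root rk pe -> loopless src tgt P -> W \subset P ->
  ~~ odd #|[set v | (root v == r) && odd (edeg W v)]|.
Proof.
move=> fo ll sW; rewrite -odd_bigsum sum_edeg; last first.
  by move=> e eW; apply: ll; apply: (subsetP sW).
rewrite (_ : [set e in W | root (tgt e) == r] = [set e in W | root (src e) == r]).
  by rewrite addnn odd_double.
apply/setP => e; rewrite !inE; case eW: (e \in W) => //=.
by rewrite (forest_edge fo) // (subsetP sW).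
Qed.

(* In a component with an even number of vertices some forest has a complement with all degrees
   odd, and a forest needs two colors; in the other components a leaf of the spanning tree is
   removed first, and its star gets four extra colors. *)
Theorem odd_coloring (P : {set E}) : loopless src tgt P ->
  exists c : E -> nat, (forall e, c e < 7) /\
    forall v k, oddz (edeg [set e in P | c e == k] v).
Proof.
move=> ll; have [P0|[e0 _]] := set_0Vmem P.
  exists (fun=> 0); split=> // v k; rewrite /edeg (_ : [set e in _ | _] = set0) ?cards0 //.
  by apply/setP => e; rewrite !inE P0 inE.
have [root [rk [pe fo]]] := forest_exists src tgt e0 P.
pose comp v := [set u | root u == root v].
pose top v := [arg max_(u > v in comp v) rk u].
have topP v : root (top v) = root v /\ forall u, root u = root v -> rk u <= rk (top v).
  rewrite /top; case: arg_maxnP => [|u]; rewrite inE // => /eqP ru H; split=> // w rw.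
  by apply: H; rewrite /= inE rw.
have compE u v : root u = root v -> comp u = comp v by move=> e; rewrite /comp e.
(* The vertices to be removed: one of greatest rank, hence a leaf of the tree, in each component
   with an odd number of vertices. *)
pose U v := odd #|comp v| && (v == top (root v)).
have UP u v : U u -> root u = root v -> u = top (root v).
  by move=> /andP[_ /eqP uu] ru; rewrite [LHS]uu ru.
have parU v : root v != v -> ~~ U (par pe v).
  move=> rv; have [_ _ pr pk] := forest_pe fo rv.
  apply/negP => /andP[_ /eqP pt]; have := (topP (root (par pe v))).2 v.
  rewrite -pt (forest_idem fo) -/(par pe v) in pr pk *; rewrite pr => /(_ erefl).
  by rewrite pk ltnn.
pose Q := [set e in P | ~~ U (src e) && ~~ U (tgt e)].
have sQP : Q \subset P by apply/subsetP => e; rewrite inE => /andP[].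
have llQ : loopless src tgt Q by move=> e eQ; apply: ll; apply: (subsetP sQP).
have incQ e v : e \in Q -> inc v e -> ~~ U v.
  by rewrite inE => /and3P[_ us ut] /orP[] /eqP->.
pose N v := (root v != v) && ~~ U v.
have peQ v : N v -> pe v \in Q.
  move=> /andP[rv uv]; have [eP iv _ _] := forest_pe fo rv.
  rewrite inE eP /=; have := parU _ rv; move: iv uv; rewrite /par /other /inc.
  by case: eqP => [<- _ -> ->//|_ /= /eqP <- -> ->].
have [J [JN JP]] : exists J : {set V}, {in J, forall v, N v} /\
    forall v, N v -> odd (edeg (pe @: J) v) = ~~ odd (edeg Q v).
  by apply: (tree_join fo ll) => v /andP[].
have Jnr : {in J, forall v, root v != v} by move=> v /JN/andP[].
have sJQ : pe @: J \subset Q by apply/subsetP => e /imsetP[v /JN vN ->]; apply: peQ.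
pose O := Q :\: pe @: J.
have oddO v : N v -> odd (edeg O v).
  by move=> Nv; have := congr1 odd (edegD src tgt v sJQ); rewrite oddD JP //; case: odd => /=; case: odd.
have edegU0 (F : {set E}) v : F \subset Q -> U v -> edeg F v = 0.
  move=> sF uv; apply/eqP; rewrite cards_eq0; apply/eqP/setP => e; rewrite !inE.
  apply/negbTE/negP => /andP[eF iv]; have := incQ _ _ (subsetP sF _ eF) iv.
  by rewrite uv.
have sOQ : O \subset Q by apply: subsetDl.
(* At a root the parity is forced: after the removal of [U] the component has an even number of
   vertices, and by the handshake lemma an even number of vertices of odd degree. *)
have oddO' v : ~~ U v -> odd (edeg O v).
  move=> uv; case rv: (root v == v); last by apply: oddO; rewrite /N rv.
  apply/negPn/negP => ev.
  have := edeg_sum_even v fo ll (subset_trans sOQ sQP); apply/negP/negPn.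
  have <- : #|comp v :\: [set u | U u] :\ v| = #|[set u | (root u == v) && odd (edeg O u)]|.
    apply: eq_card => u; rewrite !inE (eqP rv).
    case: (u =P v) => [->|/eqP nuv] /=; first by rewrite (negbTE ev) andbF.
    case: (root u =P v) => [ru|]; rewrite ?andbF //= andbT.
    case uu: (U u); first by rewrite edegU0.
    by rewrite oddO // /N uu ru eq_sym nuv.
  have vc : v \in comp v :\: [set u | U u] by rewrite !inE uv eqxx.
  have : odd #|comp v :\: [set u | U u]| = false.
    have := cardsID [set u | U u] (comp v).
    case oc: (odd #|comp v|).
      have -> : comp v :&: [set u | U u] = [set top (root v)].
        apply/setP => u; rewrite !inE; apply/andP/eqP => [[/eqP ru /UP]|->]; first by apply.
        rewrite (topP _).1 (forest_idem fo) eqxx /U (compE _ v) ?oc /=.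
          by rewrite (topP _).1 (forest_idem fo).
        by rewrite (topP _).1 (forest_idem fo).
      by rewrite cards1 => /(congr1 odd); rewrite oc add1n /=; case: odd.
    have -> : comp v :&: [set u | U u] = set0.
      apply/setP => u; rewrite !inE; apply/negbTE/negP => /andP[/eqP ru /andP[]].
      by rewrite (compE _ v) // oc.
    by rewrite cards0 add0n => ->.
  by rewrite (cardsD1 v) vc add1n /= => /negbFE.
have [two twoP] := forest_two_coloring fo Jnr.
have starP c : exists st : E -> nat, [/\ forall e, st e < 4,
      forall v k, oddz #|[set e in [set e in P | inc c e] | (other src tgt c e == v) && (st e == k)]| &
      forall k, oddz #|[set e in [set e in P | inc c e] | st e == k]|].
  exact: odd_star_coloring.
have [st stP] := fin_all_exists starP.
pose J1 := [set v in J | two v].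
(* Color 0 is for the part with odd degrees, 1 and 2 for the forest, and 3 to 6 for the star of the
   removed leaf. *)
pose c e := if e \in Q then (if e \in O then 0 else if e \in pe @: J1 then 1 else 2)
  else 3 + st (top (root (src e))) e.
exists c; split=> [e|v k].
  rewrite /c; case: ifP => _; first by case: ifP => // _; case: ifP.
  by have [/(_ e)] := stP (top (root (src e))).
have memJ1 u : u \in J -> (pe u \in pe @: J1) = two u.
  move=> uJ; apply/imsetP/idP => [[w]|tu]; last by exists u; rewrite // inE uJ.
  rewrite inE => /andP[wJ tw] /(pe_inj fo).
  by rewrite !inE !Jnr // => /(_ isT isT) ->.
have twoE b : [set e in pe @: J | (e \in pe @: J1) == b] = pe @: [set u in J | two u == b].
  apply/setP => e; rewrite inE; apply/andP/imsetP.
    by case=> /imsetP[u uJ ->]; rewrite memJ1 // => tu; exists u; rewrite // inE uJ.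
  case=> u; rewrite inE => /andP[uJ tb] ->; rewrite memJ1 //.
  by split=> //; apply: imset_f.
have two_oddz b : oddz (edeg (pe @: [set u in J | two u == b]) v).
  rewrite (edeg_pe fo ll) => [|u]; last by rewrite inE => /andP[/Jnr].
  have := twoP v b; congr (oddz (_ + _)); first by rewrite inE.
  by apply: eq_card => u; rewrite !inE andbAC -andbA.
have cQ e : e \in Q -> (c e == k) = match k with 0 => e \in O | 1 => (e \in pe @: J) && (e \in pe @: J1)
    | 2 => (e \in pe @: J) && (e \notin pe @: J1) | _ => false end.
  move=> eQ; rewrite /c eQ /O in_setD eQ andbT.
  case: (e \in pe @: J) => /=; first by case: ifP => _; case: k => [|[|[|]]].
  by case: k => [|[|[|]]].
case: (ltnP k 3) => k3.
  have kE : [set e in P | c e == k] = [set e in Q | c e == k].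
    apply/setP => e; rewrite [LHS]inE [RHS]inE; case eQ: (e \in Q).
      by rewrite (subsetP sQP _ eQ).
    by rewrite /c eQ; apply/negbTE/negP => /andP[_ /eqP ek]; move: k3; rewrite -ek; clear; lia.
  have kE' (F : {set E}) : F \subset Q -> {in Q, forall e, (c e == k) = (e \in F)} ->
      [set e in Q | c e == k] = F.
    move=> sF kF; apply/setP => e; rewrite [LHS]inE; case eQ: (e \in Q); first by rewrite kF.
    by apply/esym/negbTE/negP => /(subsetP sF); rewrite eQ.
  rewrite kE; case: k k3 cQ kE' {kE} => [|[|[|//]]] _ cQ kE'.
  - rewrite (kE' O) //; case uv: (U v); first by rewrite edegU0.
    by rewrite /oddz oddO' ?uv ?orbT.
  - rewrite (kE' (pe @: [set u in J | two u == true])) //.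
      by rewrite -twoE (subset_trans _ sJQ) //; apply/subsetP => e; rewrite inE => /andP[].
    by move=> e eQ; rewrite cQ // -twoE inE eqb_id.
  - rewrite (kE' (pe @: [set u in J | two u == false])) //.
      by rewrite -twoE (subset_trans _ sJQ) //; apply/subsetP => e; rewrite inE => /andP[].
    by move=> e eQ; rewrite cQ // -twoE inE eqbF_neg.
pose t := top (root v).
have PQ e : e \in P -> e \notin Q -> inc v e -> inc t e /\ U t.
  move=> eP; rewrite inE eP /= negb_and !negbK => /orP[] ue iv.
    by rewrite /t -(UP _ v ue) ?inc_src // -(forest_inc fo eP iv).
  by rewrite /t -(UP _ v ue) ?inc_tgt // -(forest_edge fo eP) -(forest_inc fo eP iv).
have memE e : inc v e -> (e \in [set e in P | c e == k]) =
    [&& e \in P, U t, inc t e & st t e == k - 3].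
  move=> iv; rewrite inE; case eP: (e \in P) => //=.
  case eQ: (e \in Q).
    have -> : U t && (inc t e && (st t e == k - 3)) = false.
      by apply/negbTE/negP => /and3P[ut it _]; have := incQ _ _ eQ it; rewrite ut.
    have : c e < 3 by rewrite /c eQ; case: ifP => // _; case: ifP.
    by move: (c e) k3; clear => m k3 m3; apply/negbTE/eqP; lia.
  have [-> ->] := PQ _ eP (negbT eQ) iv.
  rewrite /c eQ -(forest_inc fo eP iv) -/t /=.
  by move: (st t e) k3; clear => m k3; apply/eqP/eqP; lia.
have [_ st1 st2] := stP t.
case ut: (U t); last first.
  rewrite /edeg (_ : [set e in _ | _] = set0) ?cards0 //.
  apply/setP => e; rewrite [LHS]inE [RHS]inE; case iv: (inc v e); rewrite ?andbF // andbT.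
  by rewrite memE // ut andbF.
have [vt|/eqP nvt] := v =P t.
  have := st2 (k - 3); congr oddz; apply: eq_card => e.
  rewrite [RHS]inE; case iv: (inc v e); last by rewrite -vt !inE iv !andbF.
  by rewrite memE // ut -vt !inE iv /= !andbT.
have := st1 v (k - 3); congr oddz; apply: eq_card => e.
rewrite [RHS]inE; case iv: (inc v e); last first.
  rewrite andbF !inE; apply/negbTE/negP => /and3P[/andP[_ it] /eqP ov _].
  by rewrite -ov inc_other in iv.
rewrite memE // ut andbT inE [_ \in [set e in P | _]]inE -!andbA /=; case: (e \in P) => //=.
case it: (inc t e) => //=; suff -> : other src tgt t e = v by rewrite eqxx.
by apply/esym/other_eq.
Qed.

End OddColoring.

(** * Coloring even orientable graphs *)

(** Edges are split off two at a time at a common tail. [p] exchanges the edges of a pair, [g] is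
    their common label, and [L] contains exactly one edge of each pair. *)
Lemma pairing (V E C : finType) (o : E -> V) (ok : C -> E -> bool) (c0 : C) (W : {set E}) :
  (forall v, ~~ odd (outdeg W o v)) ->
  (forall e f, e \in W -> f \in W -> o e = o f -> exists c, ok c e && ok c f) ->
  exists (p : E -> E) (g : E -> C) (L : {set E}), forall e, e \in W ->
    [/\ p e \in W, p (p e) = e, o (p e) = o e &
     [/\ g (p e) = g e, ok (g e) e & (p e \in L) = (e \notin L)]].
Proof.
have [n] := ubnP #|W|; elim: n W => // n IH W; rewrite ltnS => cW evW okW.
have [W0|[e1 e1W]] := set_0Vmem W.
  by exists id, (fun=> c0), set0 => e; rewrite W0 inE.
have [e2] : exists e2, e2 \in [set e in W | o e == o e1] :\ e1.
  apply/card_gt0P; have := evW (o e1); rewrite /outdeg (cardsD1 e1) inE e1W eqxx /=.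
  by case: #|_|.
rewrite !inE => /and3P[n21 e2W /eqP o21].
pose W' := W :\ e1 :\ e2.
have inW' e : (e \in W') = [&& e != e2, e != e1 & e \in W] by rewrite !inE.
have [p [g [L PL]]] : exists (p : E -> E) (g : E -> C) (L : {set E}), forall e, e \in W' ->
    [/\ p e \in W', p (p e) = e, o (p e) = o e &
     [/\ g (p e) = g e, ok (g e) e & (p e \in L) = (e \notin L)]].
  apply: IH => [|v|e f].
  - by move: cW; rewrite (cardsD1 e1 W) e1W (cardsD1 e2 (W :\ e1)) -/W' !inE n21 e2W; clear; lia.
  - have := evW v; suff -> : outdeg W o v = (o e1 == v).*2 + outdeg W' o v by rewrite oddD odd_double.
    rewrite /outdeg (cardsD1 e1) (cardsD1 e2 (_ :\ e1)) !inE n21 e1W e2W o21 /= addnA addnn.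
    by congr (_ + _); apply: eq_card => e; rewrite !inE !andbA.
  - by rewrite !inW' => /and3P[_ _ eW] /and3P[_ _ fW]; apply: okW.
have [c /andP[ok1 ok2]] := okW _ _ e1W e2W (esym o21).
exists (fun e => if e == e1 then e2 else if e == e2 then e1 else p e),
  (fun e => if (e == e1) || (e == e2) then c else g e),
  [set e | (e == e1) || (e != e2) && (e \in L)] => e eW.
rewrite !in_set; case: (e =P e1) => [->|/eqP ne1] /=.
  by rewrite eqxx (negbTE n21).
case: (e =P e2) => [->|/eqP ne2] /=; first by rewrite eqxx.
have eW' : e \in W' by rewrite inW' ne1 ne2.
have [pW pp po [pg pok pL]] := PL _ eW'.
have := pW; rewrite inW' => /and3P[/negbTE -> /negbTE -> ->] /=.
by rewrite pp pL.
Qed.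

Section LocallyIrregular.

Variables (V E : finType) (src tgt : E -> V).
Local Notation edeg := (edeg src tgt).
Local Notation inc := (inc src tgt).
Local Notation other := (other src tgt).

Definition li_edges (W : {set E}) : Prop :=
  {in W, forall e, edeg W (src e) != edeg W (tgt e)}.

Definition li_edge_colorable (n : nat) (W : {set E}) : Prop :=
  exists c : E -> nat, {in W, forall e, c e < n} /\
    forall k, li_edges [set e in W | c e == k].

Lemma li_edge_colorable0 n : li_edge_colorable n set0.
Proof. by exists (fun=> 0); split=> [e|k e]; rewrite !inE. Qed.

Lemma li_edge_colorable1 W : li_edges W -> li_edge_colorable 1 W.
Proof.
move=> liW; exists (fun=> 0); split=> // k; case: (0 =P k) => [_|_].
  by rewrite (_ : [set e in W | _] = W) //; apply/setP => e; rewrite inE andbT.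
by move=> e; rewrite inE andbF.
Qed.

Lemma li_edge_colorableU m n (W1 W2 : {set E}) : [disjoint W1 & W2] ->
  li_edge_colorable m W1 -> li_edge_colorable n W2 ->
  li_edge_colorable (m + n) (W1 :|: W2).
Proof.
move=> dj [c1 [cm li1]] [c2 [cn li2]].
have in2 e : e \in W2 -> e \in W1 = false by move/(disjointFl dj).
exists (fun e => if e \in W1 then c1 e else m + c2 e); split=> [e|k].
  rewrite inE => /orP[eW|eW]; first by rewrite eW ltn_addr // cm.
  by rewrite in2 // ltn_add2l cn.
case: (ltnP k m) => km.
  rewrite (_ : [set e in _ | _] = [set e in W1 | c1 e == k]) //.
  apply/setP => e; rewrite !inE; case e1: (e \in W1) => //=.
  by apply/negbTE/negP => /andP[_ /eqP ek]; move: km; rewrite -ek ltnNge leq_addr.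
rewrite (_ : [set e in _ | _] = [set e in W2 | c2 e == k - m]) //.
apply/setP => e; rewrite !inE; case e1: (e \in W1) => /=.
  rewrite (disjointFr dj) //=; apply/negbTE/negP => /eqP ek.
  by have := cm _ e1; rewrite ek ltnNge km.
by rewrite -{1}(subnKC km) eqn_add2l.
Qed.

Definition even_orientable (W : {set E}) : Prop :=
  exists o : E -> V, (forall e, inc (o e) e) /\ forall v, ~~ odd (outdeg W o v).

Lemma even_orientableU (W1 W2 : {set E}) : [disjoint W1 & W2] ->
  even_orientable W1 -> even_orientable W2 -> even_orientable (W1 :|: W2).
Proof.
move=> dj [o1 [i1 ev1]] [o2 [i2 ev2]].
exists (fun e => if e \in W1 then o1 e else o2 e); split=> [e|v]; first by case: ifP.
rewrite /outdeg -(cardsID W1) oddD negb_add.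
rewrite (_ : _ :&: _ = [set e in W1 | o1 e == v]); last first.
  by apply/setP => e; rewrite !inE; case: (e \in W1); rewrite ?andbF // andbT.
rewrite (_ : _ :\: _ = [set e in W2 | o2 e == v]); last first.
  apply/setP => e; rewrite !inE; case e1: (e \in W1); rewrite //= (disjointFr dj) //.
by rewrite (negbTE (ev1 v)) (negbTE (ev2 v)).
Qed.

Lemma even_orientable0 : even_orientable set0.
Proof.
exists src; split=> [e|v]; first exact: inc_src.
by rewrite /outdeg (_ : [set e in _ | _] = set0) ?cards0 //; apply/setP => e; rewrite !inE.
Qed.

Lemma even_involution (X : {set E}) (p : E -> E) (L : {set E}) :
  {in X, forall e, [/\ p e \in X, p (p e) = e & (p e \in L) = (e \notin L)]} -> ~~ odd #|X|.
Proof.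
move=> pP; rewrite -(cardsID L) (_ : X :\: L = p @: (X :&: L)).
  rewrite card_in_imset ?addnn ?odd_double //.
  move=> e f /setIP[/pP[_ ee _] _] /setIP[/pP[_ ff _] _] epf.
  by rewrite -ee epf ff.
apply/setP => e; rewrite inE; apply/andP/imsetP => [[eL eX]|[f /setIP[fX fL] ->]].
  by have [pX pp pL] := pP _ eX; exists (p e); rewrite ?pp // inE pX pL eL.
by have [pX pp pL] := pP _ fX; rewrite pL fL pX.
Qed.

End LocallyIrregular.

Section CherryColoring.

Variables (V E : finType) (src tgt : E -> V).
Hypothesis simp : simple_edges src tgt.

(* Edges with a common tail are paired into cherries; a cherry is seen as an edge between its two
   heads. Tails then have even degree in every color class, and heads have odd degree. *)
Theorem cherry_coloring (C : finType) (c0 : C) (A : C -> pred V) (W : {set E}) (o : E -> V) :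
  loopless src tgt W -> (forall e, inc src tgt (o e) e) -> (forall v, ~~ odd (outdeg W o v)) ->
  (forall e f, e \in W -> f \in W -> o e = o f ->
    exists c, [/\ A c (o e), ~~ A c (other src tgt (o e) e) & ~~ A c (other src tgt (o f) f)]) ->
  li_edge_colorable src tgt (7 * #|C|) W.
Proof.
move=> ll io evW sep.
pose hd e := other src tgt (o e) e.
pose ok c e := A c (o e) && ~~ A c (hd e).
have [p [g [L pP]]] : exists (p : E -> E) (g : E -> C) (L : {set E}), forall e, e \in W ->
    [/\ p e \in W, p (p e) = e, o (p e) = o e &
     [/\ g (p e) = g e, ok (g e) e & (p e \in L) = (e \notin L)]].
  apply: pairing => // e f eW fW oef; have [c [c1 c2 c3]] := sep _ _ eW fW oef.
  by exists c; rewrite /ok /hd c1 c2 c3 -oef c1.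
(* One representative of each cherry with label [c], viewed below as an edge with ends [hd e] and
   [hd (p e)]. *)
pose P c := [set e in W | (e \in L) && (g e == c)].
have hd_neq e : e \in W -> hd e != hd (p e).
  move=> eW; have [pW pp po [_ _ pL]] := pP _ eW; apply/eqP => hh.
  have oh : o e != hd e by rewrite eq_sym other_neq // ll.
  have ee : e = p e.
    apply: (simp oh); rewrite ?io //; first exact: inc_other.
      by rewrite -po io.
    by rewrite hh inc_other.
  by move: pL; rewrite -ee; case: (e \in L).
have llP c : loopless hd (hd \o p) (P c).
  by move=> e; rewrite inE => /andP[eW _]; apply: hd_neq.
have [x xP] := fin_all_exists (fun c => odd_coloring (llP c)).
pose lead e := if e \in L then e else p e.
have leadP e : e \in W -> [/\ lead e \in W, lead e \in L, g (lead e) = g e & lead (p e) = lead e].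
  move=> eW; have [pW pp po [pg _ pL]] := pP _ eW.
  by rewrite /lead pL; case eL: (e \in L) => /=; rewrite ?pp ?pL ?eL.
(* Both edges of a cherry take the color of its representative, within the block of 7 colors
   reserved for its label. *)
pose col e := enum_rank (g e) * 7 + x (g e) (lead e).
exists col; split=> [e eW|k].
  rewrite /col; have := ltn_ord (enum_rank (g e)); have := (xP (g e)).1 (lead e).
  by move: #|C| (x _ _) (nat_of_ord _); clear => a b c; lia.
set X := [set e in W | col e == k].
move=> e0 e0X; have := e0X; rewrite inE => /andP[e0W /eqP ck0].
pose c := g e0; pose j := x c (lead e0).
have XE e : (e \in X) = [&& e \in W, g e == c & x c (lead e) == j].
  rewrite inE; case eW: (e \in W) => //=; rewrite -ck0.
  apply/eqP/andP => [|[/eqP gc /eqP xj]]; last by rewrite /col gc xj.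
  rewrite /col => eq7; have x1 := (xP (g e)).1 (lead e); have x2 := (xP c).1 (lead e0).
  have gc : g e = c.
    apply: enum_rank_inj; apply: val_inj => /=; move: eq7 x1 x2; rewrite -/c.
    by move: (nat_of_ord _) (x _ _) (nat_of_ord _) (x _ _); clear => a b c d; lia.
  by split; first exact/eqP; move/eqP: eq7; rewrite gc -/c eqn_add2l.
have pX e : e \in X -> p e \in X.
  rewrite !XE => /and3P[eW gc xj]; have [pW _ _ [pg _ _]] := pP _ eW.
  by have [_ _ _ ->] := leadP _ eW; rewrite pW pg gc xj.
have okX e : e \in X -> A c (o e) && ~~ A c (hd e).
  by rewrite XE => /and3P[eW /eqP <- _]; have [_ _ _ []] := pP _ eW.
have evenA v : A c v -> ~~ odd (edeg src tgt X v).
  move=> Av; rewrite /edeg.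
  have -> : [set e in X | inc src tgt v e] = [set e in X | o e == v].
    apply/setP => e; rewrite [LHS]inE [RHS]inE; case eX: (e \in X) => //=.
    have /andP[_ nA] := okX _ eX; rewrite (incE v (io e)) -/(hd e) eq_sym.
    case: (v =P hd e) => [vh|_]; last by rewrite orbF.
    by rewrite -vh Av in nA.
  apply: (@even_involution _ _ p L) => e; rewrite inE => /andP[eX /eqP oe].
  have eW : e \in W by move: eX; rewrite inE => /andP[].
  by have [_ pp po [_ _ pL]] := pP _ eW; rewrite inE pX // po oe eqxx.
(* All edges of [X] at such a vertex point into it, and [lead] maps them bijectively to the cherries
   of this color that have [v] as a head. *)
have oddA v : ~~ A c v -> oddz (edeg src tgt X v).
  move=> nAv; have := (xP c).2 v j; congr oddz; rewrite /edeg.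
  have incX e : e \in X -> inc src tgt v e = (hd e == v).
    move=> eX; have /andP[Ao _] := okX _ eX; rewrite (incE v (io e)) -/(hd e) orbC eq_sym.
    case: (v =P o e) => [vo|_]; last by rewrite orbF.
    by rewrite vo Ao in nAv.
  have <- : lead @: [set e in X | inc src tgt v e] =
      [set e in [set e in P c | x c e == j] | inc hd (hd \o p) v e].
    apply/setP => l; apply/imsetP/idP => [[e]|].
      rewrite inE => /andP[eX iv] ->; rewrite incX // in iv.
      move: eX; rewrite XE => /and3P[eW gc xj].
      have [lW lL lg _] := leadP _ eW; rewrite !inE lW lL lg gc xj /inc /=.
      have [_ pp _ _] := pP _ eW; rewrite /lead; case: ifP => _; first by rewrite eq_sym iv.
      by rewrite pp eq_sym [v == hd e]eq_sym iv orbT.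
    rewrite !inE => /andP[/andP[/and3P[lW lL gl] xl] il].
    have [pW pp po [pg _ pL]] := pP _ lW.
    have lX : l \in X by rewrite XE lW gl /lead lL xl.
    case/orP: il => /eqP vl.
      exists l; last by rewrite /lead lL.
      by rewrite in_set lX incX // vl /=.
    exists (p l); last by rewrite /lead pL lL pp.
    by rewrite in_set pX // incX ?pX // vl /=.
  rewrite card_in_imset // => e f; rewrite ![_ \in [set _ in X | _]]inE.
  move=> /andP[eX ie] /andP[fX ife]; rewrite incX // in ie; rewrite incX // in ife.
  have eW : e \in W by move: eX; rewrite inE => /andP[].
  have fW : f \in W by move: fX; rewrite inE => /andP[].
  have [_ ppe _ _] := pP _ eW; have [_ ppf _ _] := pP _ fW.
  have := hd_neq _ eW; have := hd_neq _ fW; rewrite (eqP ie) (eqP ife).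
  rewrite /lead; case: ifP => _; case: ifP => _ // nf ne.
  - by move=> ef; rewrite -ef (eqP ie) eqxx in nf.
  - by move=> ef; rewrite ef (eqP ife) eqxx in ne.
  - by move=> ef; rewrite -ppe ef ppf.
have /andP[Ao nAh] := okX _ e0X.
have pos v : inc src tgt v e0 -> 0 < edeg src tgt X v.
  by move=> iv; apply/card_gt0P; exists e0; rewrite inE e0X.
(* The degree is even at the tail; at the head it is positive, hence odd. *)
have main : edeg src tgt X (o e0) != edeg src tgt X (hd e0).
  apply/eqP => eqd; have := oddA _ nAh; rewrite /oddz -eqd (negbTE (evenA _ Ao)) orbF.
  by rewrite eqn0Ngt pos ?io.
have := main; rewrite /hd /other; move: (io e0); rewrite /inc.
by case: (o e0 =P src e0) => [->//|_ /= /eqP ->]; rewrite eq_sym.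
Qed.

End CherryColoring.

(** * Removing a locally irregular graph to reach an even orientable one *)

Section Orientations.

Variables (V E : finType) (src tgt : E -> V).
Local Notation edeg := (edeg src tgt).
Local Notation inc := (inc src tgt).
Local Notation other := (other src tgt).
Local Notation li_edges := (li_edges src tgt).
Local Notation even_orientable := (even_orientable src tgt).

Lemma outdegD (F H : {set E}) (o : E -> V) v : F \subset H ->
  outdeg H o v = outdeg F o v + outdeg (H :\: F) o v.
Proof.
move=> /subsetP sF; rewrite /outdeg -(cardsID F); congr (_ + _); apply: eq_card => e.
  by rewrite !inE; case eF: (e \in F); rewrite ?andbF ?andbT //= sF.
by rewrite !inE andbA.
Qed.

(** The forest corrects all parities except at roots; there the right parity follows from the number
    of edges in the component. *)
Lemma orientation_with_parity (P W : {set E}) root rk pe (R : pred V) (t : V -> bool) :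
  forest src tgt P root rk pe -> loopless src tgt P -> W \subset P ->
  (forall v, root v != v -> R (root v) -> pe v \in W) ->
  {in W, forall e, R (root (src e))} -> (forall v, t v -> R (root v)) ->
  (forall r, R r -> odd #|[set e in W | root (src e) == r]| =
                    odd #|[set v | (root v == r) && t v]|) ->
  exists o : E -> V, (forall e, inc (o e) e) /\ forall v, odd (outdeg W o v) = t v.
Proof.
move=> fo ll sW peW RW Rt par.
have [|o [io oP]] := @orientation _ _ _ _ _ _ _ _ fo ll
  (fun v => (root v != v) && R (root v)) W t sW.
  by move=> v /andP[rv Rv]; split=> //; apply: peW.
exists o; split=> // v; case Rv: (R (root v)); last first.
  have -> : t v = false by apply/negbTE/negP => /Rt; rewrite Rv.
  rewrite (_ : outdeg W o v = 0) //; apply/eqP; rewrite cards_eq0; apply/eqP/setP => e.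
  rewrite !inE; apply/negbTE/negP => /andP[eW /eqP oe]; have := RW _ eW.
  by rewrite -(forest_inc fo (subsetP sW _ eW) (io e)) oe Rv.
case: (boolP (root v == v)) => [/eqP rv|rv]; last by rewrite oP // rv.
have := par v; rewrite -{1}rv Rv => /(_ isT).
rewrite (odd_outdeg_comp fo _ sW (fun e _ => io e)).
rewrite (cardsD1 v) [in RHS](cardsD1 v) !inE rv eqxx /= !oddD !oddb.
rewrite (_ : _ :\ v = [set u | (root u == v) && t u] :\ v); last first.
  apply/setP => u; rewrite !inE; case: (u =P v) => //= /eqP uv.
  by case: (root u =P v) => //= ru; rewrite oP // ru eq_sym uv -rv Rv.
exact: addIb.
Qed.

Definition odd_only_at (H : {set E}) (v : V) : Prop :=
  exists o : E -> V, (forall e, inc (o e) e) /\ forall u, odd (outdeg H o u) = (u == v).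

Hypothesis ll : forall e, src e != tgt e.
Let llW (W : {set E}) : loopless src tgt W. Proof. by move=> e _; apply: ll. Qed.

(** Reversing [e] moves the unique odd outdegree from one end to the other. *)
Lemma odd_only_at_step (H : {set E}) e u w : e \in H -> inc u e -> inc w e ->
  odd_only_at H u -> odd_only_at H w.
Proof.
move=> eH iu iw [o [io oP]]; case: (eqVneq w u) => [->|nwu]; first by exists o.
exists (flip src tgt [set e] o); split=> [f|v]; first by apply: flip_inc.
rewrite odd_outdeg_flip ?sub1set //.
rewrite oP edeg1 oddb (incE v iu) -(other_eq iu iw nwu).
by case: (v =P u) => [->|_] //=; rewrite eq_sym (negbTE nwu).
Qed.

Lemma even_orientable_odd_only (H1 H2 : {set E}) v : [disjoint H1 & H2] ->
  odd_only_at H1 v -> odd_only_at H2 v -> even_orientable (H1 :|: H2).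
Proof.
move=> dj [o1 [i1 ev1]] [o2 [i2 ev2]].
exists (fun e => if e \in H1 then o1 e else o2 e); split=> [e|u]; first by case: ifP.
rewrite (@outdegD H1) ?subsetUl // oddD.
have -> : outdeg H1 (fun e => if e \in H1 then o1 e else o2 e) u = outdeg H1 o1 u.
  by apply: eq_card => e; rewrite !inE; case: (e \in H1).
have -> : outdeg ((H1 :|: H2) :\: H1) (fun e => if e \in H1 then o1 e else o2 e) u = outdeg H2 o2 u.
  apply: eq_card => e; rewrite !inE; case e1: (e \in H1) => //=.
  by rewrite (disjointFr dj).
by rewrite ev1 ev2 addbb.
Qed.

Hypothesis simp : simple_edges src tgt.

(** The odd outdegree can be placed at any vertex of the piece, so two pieces that meet can cancel
    their odd outdegrees at a common vertex. *)
Definition odd_piece (H : {set E}) : Prop :=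
  li_edges H /\ forall v, 0 < edeg H v -> odd_only_at H v.

Lemma set_seqE (s : seq E) (p : pred E) : uniq s ->
  #|[set e in [set e in s] | p e]| = count p s.
Proof.
move=> us; rewrite -size_filter -(card_uniqP (filter_uniq p us)) -cardsE; apply: eq_card => e.
by rewrite !inE mem_filter andbC.
Qed.

Section Piece.

Variables (K : {set E}) (v : V).
Hypothesis liK : li_edges K.
Hypothesis maxv : forall u, edeg K u <= edeg K v.

(** The edges leaving [v] form a star with at least three edges. Without it the outdegree of [v] is
    0, and the other outdegrees keep their even values. *)
Lemma star_piece (o : E -> V) : (forall e, inc (o e) e) ->
  (forall u, odd (outdeg K o u) = (u == v)) -> 2 < outdeg K o v ->
  exists2 H : {set E}, H \subset K & odd_piece H /\ even_orientable (K :\: H).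
Proof.
move=> io oP o3; pose H := [set e in K | o e == v].
have sH : H \subset K by apply/subsetP => e; rewrite inE => /andP[].
have oH u : outdeg H o u = if u == v then outdeg K o v else 0.
  case: eqP => [->|/eqP uv]; first by apply: eq_card => e; rewrite !inE -andbA andbb.
  apply/eqP; rewrite cards_eq0; apply/eqP/setP => e; rewrite !inE.
  by case: (o e =P v) => [->|]; rewrite ?andbF // andbT eq_sym (negbTE uv) andbF.
have iv e : e \in H -> inc v e by rewrite inE => /andP[_ /eqP <-]; apply: io.
have dHv : edeg H v = outdeg K o v.
  apply: eq_card => e; rewrite !inE; case eK: (e \in K) => //=.
  by case: (o e =P v) => //= oe; rewrite -oe io.
have dH u : u != v -> edeg H u <= 1 by move=> uv; apply: edeg_star simp uv iv.
have oddH : odd_only_at H v.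
  by exists o; split=> // u; rewrite oH; case: eqP => // _; rewrite oP eqxx.
exists H => //; split; last first.
  exists o; split=> // u; have := congr1 odd (outdegD o u sH); rewrite oddD oP oH.
  by case: eqP => [_|_]; rewrite ?oP ?eqxx /=; case: (odd _).
split=> [e eH|u]; last first.
  case/card_gt0P => e; rewrite inE => /andP[eH iu].
  by apply: odd_only_at_step eH (iv _ eH) iu oddH.
have := iv _ eH; have := ll e; move: o3; rewrite -dHv /inc => o3 nl.
case/orP=> /eqP ve; rewrite -ve in nl *.
  by have := dH (tgt e); rewrite eq_sym nl => /(_ isT); move: o3; clear => a b; apply/eqP; lia.
by have := dH (src e); rewrite nl => /(_ isT); move: o3; clear => a b; apply/eqP; lia.
Qed.


Lemma inc_nat a e u : inc a e -> inc u e = (u == a) + (u == other a e) :> nat.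
Proof.
move=> ia; rewrite (incE u ia); have := other_neq (ll e) ia.
by case: (u =P a) => [->|_] //=; rewrite eq_sym => /negbTE ->.
Qed.

Lemma edeg_seq (s : seq E) u : uniq s -> edeg [set e in s] u = count (inc u) s.
Proof. exact: set_seqE. Qed.

(** Reversing [F] preserves all parities and turns [f] and [g] away from [v]. Together with [e] this
    gives three edges out of [v], as [star_piece] requires. *)
Lemma cycle_piece (o : E -> V) e f g (F : {set E}) : (forall e, inc (o e) e) ->
  (forall u, odd (outdeg K o u) = (u == v)) ->
  [/\ e \in K, o e = v & e \notin F] -> [/\ f \in F, g \in F & f != g] ->
  [/\ inc v f, inc v g, o f != v & o g != v] -> F \subset K ->
  (forall u, ~~ odd (edeg F u)) ->
  exists2 H : {set E}, H \subset K & odd_piece H /\ even_orientable (K :\: H).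
Proof.
move=> io oP [eK oe eF] [fF gF fg] [vf vg ovf ovg] sF evF.
apply: (@star_piece (flip src tgt F o)) => [h|u|].
- by apply: flip_inc.
- by rewrite odd_outdeg_flip // (negbTE (evF u)) addbF oP.
have us : uniq [:: e; f; g].
  by rewrite /= !inE fg negb_or !andbT; apply/andP; split; apply: contraNneq eF => ->.
rewrite -[2]/(size [:: f; g]) -[size _]/((size [:: e; f; g]).-1) prednK //.
rewrite -(card_uniqP us) -cardsE; apply: subset_leq_card; apply/subsetP => h.
have oth x : inc v x -> o x != v -> other (o x) x = v.
  by move=> vx; rewrite eq_sym => ovx; rewrite -(other_eq (io x) vx ovx).
rewrite !inE /flip => /or3P[] /eqP->.
- by rewrite eK (negbTE eF) oe eqxx.
- by rewrite fF (subsetP sF _ fF) oth ?eqxx.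
- by rewrite gF (subsetP sF _ gF) oth ?eqxx.
Qed.

Ltac simpl_neq := repeat match goal with
  | H : is_true (?a != ?b) |- context [?a == ?b] => rewrite (negbTE H)
  | H : is_true (?a != ?b) |- context [?b == ?a] => rewrite [b == a]eq_sym (negbTE H)
  end.

(* The piece is a 3-star with center v and two subdivided legs, or else there is a cycle of length
   3 or 4 whose reversal gives three edges out of v. *)
Lemma spider_piece (o : E -> V) e1 f2 g2 f3 g3 : (forall e, inc (o e) e) ->
  (forall u, odd (outdeg K o u) = (u == v)) ->
  [/\ e1 \in K, o e1 = v, f2 != f3 & o g2 = o f2] ->
  [/\ f2 \in K, inc v f2, o f2 != v, g2 \in K & g2 != f2] ->
  [/\ f3 \in K, inc v f3, o f3 != v, g3 \in K & g3 != f3] -> o g3 = o f3 ->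
  (other (o f2) g2 == other v e1) = (other (o f3) g3 == other v e1) ->
  exists2 H : {set E}, H \subset K & odd_piece H /\ even_orientable (K :\: H).
Proof.
move=> io oP [e1K oe1 f23 og2] [f2K vf2 of2 g2K gf2] [f3K vf3 of3 g3K gf3] og3.
have ve1 : inc v e1 by rewrite -oe1 io.
have ix2 := io f2; have ix2' := io g2; have ix3 := io f3; have ix3' := io g3.
rewrite og2 in ix2'; rewrite og3 in ix3'.
set x1 := other v e1; set x2 := o f2 in og2 of2 ix2 ix2' *.
set x3 := o f3 in og3 of3 ix3 ix3' *; set y2 := other x2 g2; set y3 := other x3 g3 => same.
have iy2 : inc y2 g2 by apply: inc_other.
have iy3 : inc y3 g3 by apply: inc_other.
have ix1 : inc x1 e1 by apply: inc_other.
have x1v : x1 != v by apply: other_neq.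
have of2E : other v f2 = x2 by rewrite -(other_eq vf2 ix2).
have of3E : other v f3 = x3 by rewrite -(other_eq vf3 ix3).
have x23 : x2 != x3.
  by apply: contraNneq f23 => x23; apply/eqP/(simp of2 ix2 vf2 _ vf3); rewrite x23.
have x12 : x1 != x2.
  apply/eqP => x12; have e12 : e1 = f2 by apply: simp x1v ix1 ve1 _ vf2; rewrite x12.
  by move: of2; rewrite /x2 -e12 oe1 eqxx.
have x13 : x1 != x3.
  apply/eqP => x13; have e13 : e1 = f3 by apply: simp x1v ix1 ve1 _ vf3; rewrite x13.
  by move: of3; rewrite /x3 -e13 oe1 eqxx.
have y2v : y2 != v.
  by apply: contraNneq gf2 => y2v; apply/eqP/(simp of2 ix2' _ ix2 vf2); rewrite -y2v.
have y3v : y3 != v.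
  by apply: contraNneq gf3 => y3v; apply/eqP/(simp of3 ix3' _ ix3 vf3); rewrite -y3v.
have y2x : y2 != x2 by apply: other_neq.
have y3x : y3 != x3 by apply: other_neq.
have nf2 : e1 != f2 by apply: contraNneq of2 => ef; rewrite /x2 -ef oe1.
have nf3 : e1 != f3 by apply: contraNneq of3 => ef; rewrite /x3 -ef oe1.
have ng2 : e1 != g2 by apply: contraNneq of2 => eg; rewrite -og2 -eg oe1.
have ng3 : e1 != g3 by apply: contraNneq of3 => eg; rewrite -og3 -eg oe1.
have ng23 : g2 != g3 by apply: contraNneq x23 => gg; rewrite -og2 gg og3.
have f2g3 : f2 != g3.
  by apply: contraNneq y3v => fg; rewrite /y3 -fg eq_sym -(other_eq _ vf2) // ?fg // eq_sym.
have f3g2 : f3 != g2.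
  by apply: contraNneq y2v => fg; rewrite /y2 -fg eq_sym -(other_eq _ vf3) // ?fg // eq_sym.
have incs u : [/\ inc u e1 = (u == v) + (u == x1) :> nat, inc u f2 = (u == v) + (u == x2) :> nat,
    inc u g2 = (u == x2) + (u == y2) :> nat, inc u f3 = (u == v) + (u == x3) :> nat
    & inc u g3 = (u == x3) + (u == y3) :> nat].
  by rewrite (inc_nat u ve1) (inc_nat u vf2) (inc_nat u vf3) (inc_nat u ix2') (inc_nat u ix3') of2E of3E.
(* If [y2 = y3], the four edges other than [e1] form a 4-cycle through [v]; if [y2 = x3] or
   [y3 = x2], three of them form a triangle. *)
case: (eqVneq y2 y3) => [y23|y23].
  have us : uniq [:: f2; g2; f3; g3] by rewrite /= !inE !negb_or; simpl_neq.
  apply: (@cycle_piece o e1 f2 f3 [set e in [:: f2; g2; f3; g3]]) => //.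
  - by split=> //; rewrite !inE; simpl_neq.
  - by rewrite !inE !eqxx ?orbT.
  - by apply/subsetP => e; rewrite !inE => /or4P[] /eqP->.
  move=> u; rewrite edeg_seq //=; have [_ -> -> -> ->] := incs u.
  by rewrite y23; case: (u == v); case: (u == x2); case: (u == x3); case: (u == y3).
case: (eqVneq y2 x3) => [y2x3|y2x3].
  have us : uniq [:: f2; g2; f3] by rewrite /= !inE !negb_or; simpl_neq.
  apply: (@cycle_piece o e1 f2 f3 [set e in [:: f2; g2; f3]]) => //.
  - by split=> //; rewrite !inE; simpl_neq.
  - by rewrite !inE !eqxx ?orbT.
  - by apply/subsetP => e; rewrite !inE => /or3P[] /eqP->.
  move=> u; rewrite edeg_seq //=; have [_ -> -> -> _] := incs u.
  by rewrite y2x3; case: (u == v); case: (u == x2); case: (u == x3).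
case: (eqVneq y3 x2) => [y3x2|y3x2].
  have us : uniq [:: f2; f3; g3] by rewrite /= !inE !negb_or; simpl_neq.
  apply: (@cycle_piece o e1 f2 f3 [set e in [:: f2; f3; g3]]) => //.
  - by split=> //; rewrite !inE; simpl_neq.
  - by rewrite !inE !eqxx ?orbT.
  - by apply/subsetP => e; rewrite !inE => /or3P[] /eqP->.
  move=> u; rewrite edeg_seq //=; have [_ -> _ -> ->] := incs u.
  by rewrite y3x2; case: (u == v); case: (u == x2); case: (u == x3).
(* By [same], if one of [y2] and [y3] equals [x1] then both do, but they are distinct. *)
have y2x1 : y2 != x1.
  apply/eqP => y2x1; move: same; rewrite y2x1 eqxx => /esym/eqP y3x1.
  by rewrite y2x1 y3x1 eqxx in y23.
have y3x1 : y3 != x1 by rewrite -same.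
have us : uniq [:: e1; f2; g2; f3; g3] by rewrite /= !inE !negb_or; simpl_neq.
pose H := [set e in [:: e1; f2; g2; f3; g3]].
have dH u : edeg H u = (u == v) * 3 + (u == x2) * 2 + (u == x3) * 2 + (u == x1) + (u == y2) + (u == y3).
  rewrite edeg_seq //=; have [-> -> -> -> ->] := incs u; clear; lia.
have sH : H \subset K by apply/subsetP => e; rewrite !inE => /or4P[|||/orP[]] /eqP->.
have oH u : odd (outdeg H o u) = (u == v).
  rewrite /outdeg set_seqE //= oe1 og2 og3 ![_ == u]eq_sym -/x2 -/x3.
  by case: (u == v); case: (u == x2); case: (u == x3).
have oddv : odd_only_at H v by exists o.
have step e w z : e \in H -> inc w e -> inc z e -> odd_only_at H w -> odd_only_at H z.
  exact: odd_only_at_step.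
have inH e : e \in [:: e1; f2; g2; f3; g3] -> e \in H by move=> es; rewrite inE.
have odd2 : odd_only_at H x2 by apply: step vf2 ix2 oddv; apply: inH; rewrite !inE eqxx ?orbT.
have odd3 : odd_only_at H x3 by apply: step vf3 ix3 oddv; apply: inH; rewrite !inE eqxx ?orbT.
exists H => //; split; last first.
  exists o; split=> // u; have := congr1 odd (outdegD o u sH); rewrite oddD oP oH.
  by case: (u == v); case: (odd _).
have dv : edeg H v = 3 by rewrite dH eqxx; simpl_neq.
have d1 : edeg H x1 = 1 by rewrite dH eqxx; simpl_neq.
have d2 : edeg H x2 = 2 by rewrite dH eqxx; simpl_neq.
have d3 : edeg H x3 = 2 by rewrite dH eqxx; simpl_neq.
have dy2 : edeg H y2 = 1 by rewrite dH eqxx; simpl_neq.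
have dy3 : edeg H y3 = 1 by rewrite dH eqxx; simpl_neq.
split=> [e|w].
  have ends a b : inc a e -> other a e = b -> edeg H a != edeg H b -> edeg H (src e) != edeg H (tgt e).
    rewrite /inc /other; case: (a =P src e) => [-> _ ->//|_ /= /eqP -> ->].
    by rewrite eq_sym.
  rewrite !inE => /or4P[|||/orP[]] /eqP ee; rewrite {}ee in ends *.
  - by apply: (ends v x1); rewrite // dv d1.
  - by apply: (ends v x2); rewrite // dv d2.
  - by apply: (ends x2 y2); rewrite // d2 dy2.
  - by apply: (ends v x3); rewrite // dv d3.
  - by apply: (ends x3 y3); rewrite // d3 dy3.
case/card_gt0P => e; rewrite inE => /andP[eH iw]; move: (eH) iw; rewrite !inE.
by case/or4P=> [|||/orP[]] /eqP ee iw; move: iw eH; rewrite ee => iw eH;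
  [apply: step eH ve1 iw oddv | apply: step eH vf2 iw oddv | apply: step eH ix2' iw odd2
  | apply: step eH vf3 iw oddv | apply: step eH ix3' iw odd3].
Qed.

(** Three edges out of [v] give a star. Otherwise exactly one edge leaves [v], and two entering
    edges, each prolonged by a second edge out of its tail, give a spider. Local irregularity at the
    vertex [v] of maximum degree settles the small degrees. *)
Lemma odd_piece_exists : odd_only_at K v ->
  exists2 H : {set E}, H \subset K & odd_piece H /\ even_orientable (K :\: H).
Proof.
move=> [o [io oP]]; case: (ltnP 2 (outdeg K o v)) => o3; first exact: star_piece io oP o3.
have o1 : outdeg K o v = 1 by have := oP v; rewrite eqxx; case: (outdeg K o v) o3 => [|[|[]]].
have [e1 Oe1] : exists e1, [set e in K | o e == v] = [set e1] by apply/cards1P/eqP.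
have : e1 \in [set e in K | o e == v] by rewrite Oe1 set11.
rewrite inE => /andP[e1K /eqP oe1].
pose I := [set e in K | inc v e && (o e != v)].
have dv : edeg K v = #|I|.+1.
  rewrite -add1n -o1 /edeg -(cardsID [set e | o e == v]); congr (_ + _); apply: eq_card => e.
    rewrite !inE; case: (e \in K) => //=; case: (o e =P v) => [<-|_]; rewrite ?andbF // io //.
  by rewrite !inE; case: (e \in K); rewrite ?andbF // andbC.
(* The outdegree of the tail of [f] is even and positive, so a second edge leaves it. *)
have [g gP] : exists g : E -> E, forall f, f \in I -> [/\ g f \in K, g f != f & o (g f) = o f].
  pose gP f g := f \in I -> [/\ g \in K, g != f & o g = o f].
  apply: (@fin_all_exists E (fun=> E) gP) => f; rewrite /gP.
  case fI: (f \in I); last by exists f.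
  move: fI; rewrite inE => /and3P[fK vf ofv].
  have : 0 < #|[set e in K | o e == o f] :\ f|.
    have := oP (o f); rewrite (negbTE ofv) /outdeg (cardsD1 f) inE fK eqxx /=.
    by case: #|_|.
  by case/card_gt0P => h; rewrite !inE => /and3P[? ? /eqP ?]; exists h.
(* [spider_piece] needs two entering edges on which [bad] agrees; among three, two such edges
   exist. *)
pose bad f := other (o f) (g f) == other v e1.
have pair f f' : f \in I -> f' \in I -> f != f' -> bad f = bad f' ->
    exists2 H : {set E}, H \subset K & odd_piece H /\ even_orientable (K :\: H).
  move=> fI fI' ff' bb; have [gK gf og] := gP _ fI; have [gK' gf' og'] := gP _ fI'.
  move: fI fI'; rewrite !inE => /and3P[fK vf of1] /and3P[fK' vf' of2].
  exact: (@spider_piece o e1 f (g f) f' (g f')).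
have degs f : f \in I -> 1 < edeg K (o f).
  move=> fI; have [gK gf og] := gP _ fI; move: fI; rewrite inE => /and3P[fK _ _].
  apply/card_gt1P; exists f, (g f).
  by rewrite !inE fK gK io -og io eq_sym.
have ends e a b : e \in K -> inc a e -> inc b e -> a != b -> edeg K a != edeg K b.
  move=> eK ia ib ab; have := liK eK; move: ia ib ab; rewrite /inc.
  by case/orP=> /eqP-> /orP[] /eqP->; rewrite ?eqxx // => _; rewrite eq_sym.
have [Ig|Is] := ltnP 2 #|I|.
  have := cardsID [set f | bad f] I; case: (ltnP 1 #|I :&: [set f | bad f]|) => [gt1|le1] cI.
    case/card_gt1P: gt1 => f [f' []]; rewrite !inE => /andP[fI bf] /andP[fI' bf'] ff'.
    by apply: (pair f f'); rewrite ?inE // bf bf'.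
  have : 1 < #|I :\: [set f | bad f]| by move: cI Ig le1; clear; lia.
  case/card_gt1P => f [f' []]; rewrite !inE => /andP[bf fI] /andP[bf' fI'] ff'.
  by apply: (pair f f'); rewrite ?inE // (negbTE bf) (negbTE bf').
(* With two entering edges [v] has degree 3, and neither is bad: a bad [f] makes [g f] join two
   neighbors of [v], both of degree 2 by maximality and local irregularity. *)
have [I2|I1] := ltnP 1 #|I|.
  have d3 : edeg K v = 3 by rewrite dv; move: I2 Is; clear; lia.
  have good f : f \in I -> bad f = false.
    move=> fI; apply/negbTE/negP => /eqP bf; have [gK gf og] := gP _ fI.
    have dx := degs _ fI; move: fI; rewrite inE => /and3P[fK vf ofv].
    have dx2 : edeg K (o f) = 2.
      have := maxv (o f); rewrite d3 leq_eqVlt; have := ends _ _ _ fK (io f) vf ofv; rewrite d3.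
      by move: (edeg K (o f)) dx; clear => n; case: eqP => //; lia.
    have x1v := other_neq (ll e1) (_ : inc v e1); rewrite -{1}oe1 io in x1v.
    have {}x1v := x1v isT.
    have xg : inc (other v e1) (g f) by rewrite -bf inc_other.
    have xe : inc (other v e1) e1 by apply: inc_other.
    have xof : o f != other v e1.
      by rewrite -bf eq_sym other_neq // -og io.
    have dx1 : edeg K (other v e1) = 2.
      have : 1 < edeg K (other v e1).
        apply/card_gt1P; exists e1, (g f); rewrite !inE e1K gK xe xg; split=> //.
        by apply: contraNneq ofv => eg; rewrite -og -eg oe1.
      have := maxv (other v e1); rewrite d3.
      have := ends _ _ _ e1K xe (_ : inc v e1) x1v; rewrite -{1}oe1 io => /(_ isT); rewrite d3.
      by move: (edeg K _); clear => n; lia.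
    have := ends _ _ _ gK (_ : inc (o f) (g f)) xg xof; rewrite -{1}og io => /(_ isT).
    by rewrite dx1 dx2.
  case/card_gt1P: I2 => f [f' [fI fI' ff']].
  by apply: (pair f f') => //; rewrite !good.
(* The maximum degree is now at most 2, and some neighbor of [v] has the same degree as [v]. *)
exfalso; have ve1 : inc v e1 by rewrite -oe1.
have [I0|[f fI]] := set_0Vmem I.
  have := ends _ _ _ e1K ve1 (inc_other src tgt v e1) _; rewrite eq_sym other_neq // => /(_ isT).
  have : 0 < edeg K (other v e1) by apply/card_gt0P; exists e1; rewrite inE e1K inc_other.
  have := maxv (other v e1); rewrite dv I0 cards0; clear; lia.
have := degs _ fI; have := maxv (o f); move: fI; rewrite inE => /and3P[fK vf ofv].
have := ends _ _ _ fK (io f) vf ofv; rewrite dv; move: I1; clear; lia.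
Qed.

End Piece.

End Orientations.

Section Decomposable.

Variables (V E : finType) (src tgt : E -> V).
Local Notation edeg := (edeg src tgt).
Local Notation inc := (inc src tgt).
Local Notation li_edges := (li_edges src tgt).
Local Notation even_orientable := (even_orientable src tgt).
Hypothesis ll : forall e, src e != tgt e.
Hypothesis simp : simple_edges src tgt.
Let llW (W : {set E}) : loopless src tgt W. Proof. by move=> e _; apply: ll. Qed.

Lemma edeg_eq0 (W : {set E}) v : (forall e, e \in W -> ~~ inc v e) -> edeg W v = 0.
Proof.
move=> nW; apply/eqP; rewrite cards_eq0; apply/eqP/setP => e; rewrite !inE.
by apply/negbTE/negP => /andP[/nW/negbTE ->].
Qed.

(** A component with an even number of edges is even orientable, and the empty set serves as its
    piece. An odd one has an orientation whose only odd outdegree is at a vertex of maximum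
    degree. *)
Lemma component_split (W : {set E}) root rk pe r :
  forest src tgt W root rk pe -> li_edges W ->
  exists H : {set E}, [/\ H \subset [set e in W | root (src e) == r],
    odd_piece src tgt H & even_orientable ([set e in W | root (src e) == r] :\: H)].
Proof.
move=> fo liW; set K := [set e in W | root (src e) == r].
have sK : K \subset W by apply/subsetP => e; rewrite inE => /andP[].
have rK : {in K, forall e, root (src e) == r} by move=> e; rewrite inE => /andP[].
have peK v : root v != v -> root v == r -> pe v \in K.
  move=> rv /eqP vr; have [pW ip _ _] := forest_pe fo rv.
  by rewrite inE pW -(forest_inc fo pW ip) vr eqxx.
have incK e v : e \in K -> inc v e -> root v = r.
  by move=> eK iv; rewrite (forest_inc fo (subsetP sK _ eK) iv) (eqP (rK _ eK)).
have cardK r' : r' == r -> [set e in K | root (src e) == r'] = K.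
  by move=> /eqP ->; apply/setP => e; rewrite !inE -andbA andbb.
have dK e v : e \in K -> inc v e -> edeg K v = edeg W v.
  move=> eK iv; apply: eq_card => f; rewrite !inE.
  case fW: (f \in W) => //=; case ivf: (inc v f); rewrite ?andbF // andbT.
  by rewrite -(forest_inc fo fW ivf) (incK _ _ eK iv) eqxx.
have liK : li_edges K.
  move=> e eK; rewrite (dK _ _ eK (inc_src src tgt e)) (dK _ _ eK (inc_tgt src tgt e)).
  by apply: liW; apply: (subsetP sK).
case oK: (odd #|K|); last first.
  exists set0; split; [exact: sub0set|split=> [e|v]|]; rewrite ?inE //.
    by rewrite edeg_eq0 // => e; rewrite inE.
  have [|o [io oP]] := @orientation_with_parity _ _ _ _ _ K _ _ _ (pred1 r) (fun=> false)
     fo (@llW W) sK peK rK (fun v h => match notF h with end).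
    move=> r' rr'; rewrite cardK // oK (_ : [set v | _] = set0) ?cards0 //.
    by apply/setP => v; rewrite !inE andbF.
  by rewrite setD0; exists o; split=> // v; rewrite oP.
have [e0 e0K] : exists e, e \in K by apply/card_gt0P; case: #|K| oK.
pose v := [arg max_(v > src e0) edeg K v].
have maxv u : edeg K u <= edeg K v by rewrite /v; case: arg_maxnP => // w _ /(_ u); apply.
have rv : root v = r.
  have : 0 < edeg K v.
    apply: leq_trans (maxv (src e0)); apply/card_gt0P; exists e0.
    by rewrite inE e0K inc_src.
  by case/card_gt0P => e; rewrite inE => /andP[]; apply: incK.
have [u|r' rr'|o [io oP]] := @orientation_with_parity _ _ _ _ _ K _ _ _ (pred1 r) (pred1 v)
     fo (@llW W) sK peK rK; last first.
- have [|H sH [oH eH]] := odd_piece_exists ll simp liK maxv; first by exists o.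
  by exists H.
- rewrite cardK // oK (_ : [set u | _] = [set v]) ?cards1 //.
  apply/setP => u; rewrite !inE /= andbC.
  by case: (u =P v) => //= ->; rewrite rv eq_sym.
- by move/eqP=> ->; rewrite /= rv.
Qed.

Lemma even_orientable_bigcup (I : finType) (F : I -> {set E}) :
  (forall i j, i != j -> [disjoint F i & F j]) -> (forall i, even_orientable (F i)) ->
  even_orientable (\bigcup_i F i).
Proof.
move=> dj ev; suff : forall s : seq I, uniq s -> even_orientable (\bigcup_(i <- s) F i).
  by move=> /(_ (index_enum I) (index_enum_uniq I)).
elim=> [_|i s IH /= /andP[nis us]]; first by rewrite big_nil; apply: even_orientable0.
rewrite big_cons; apply: even_orientableU => //; last exact: IH.
rewrite big_seq; elim/big_ind: _ => [|X Y dX dY|j js].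
- by rewrite -setI_eq0 setI0.
- by rewrite -setI_eq0 setIUr setU_eq0 !setI_eq0 dX.
- by apply: dj; apply: contraNneq nis => ->.
Qed.

(* Two pieces that meet at v merge into an even orientable set, so in a minimal family the pieces
   are pairwise vertex-disjoint. *)
Lemma odd_pieces_merge (I : finType) (H : I -> {set E}) (W : {set E}) :
  (forall i j, i != j -> [disjoint H i & H j]) -> (forall i, [disjoint H i & W]) ->
  (forall i, odd_piece src tgt (H i)) -> forall J : {set I},
  even_orientable (W :|: \bigcup_(i in ~: J) H i) ->
  exists J' : {set I}, li_edges (\bigcup_(i in J') H i) /\
    even_orientable (W :|: \bigcup_(i in ~: J') H i).
Proof.
move=> dj djW oH J; have [n] := ubnP #|J|; elim: n J => // n IH J cJ evJ.
case: (boolP [exists i in J, exists j in J, (i != j) &&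
    [exists v, (0 < edeg (H i) v) && (0 < edeg (H j) v)]]) => [|].
  case/existsP => i /andP[iJ /existsP[j /andP[jJ /andP[ij /existsP[v /andP[vi vj]]]]]].
  apply: (IH (J :\ i :\ j)).
    move: cJ; rewrite (cardsD1 i J) iJ (cardsD1 j (J :\ i)) !inE jJ eq_sym ij.
    by move: #|_| => m; clear; lia.
  have -> : \bigcup_(k in ~: (J :\ i :\ j)) H k = (H i :|: H j) :|: \bigcup_(k in ~: J) H k.
    apply/setP => e; rewrite !in_setU; apply/bigcupP/orP => [[k]|].
      rewrite !inE => kJ ek; case: (k =P i) => [ki|ki]; first by left; rewrite -ki ek.
      case: (k =P j) => [kj|kj]; first by left; rewrite -kj ek orbT.
      right; apply/bigcupP; exists k => //; rewrite inE; apply: contra kJ => kJ.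
      by rewrite kJ; do 2!case: eqP.
    case=> [/orP[ei|ej]|/bigcupP[k]]; first by exists i; rewrite // !inE eqxx andbF.
      by exists j; rewrite // !inE eqxx.
    by rewrite inE => kJ ek; exists k; rewrite // !inE (negbTE kJ) !andbF.
  rewrite setUA [W :|: _]setUC -setUA; apply: even_orientableU => //.
    rewrite -setI_eq0 setIUr setU_eq0 !setIUl !setU_eq0 !setI_eq0 !djW /=.
    have dk k : k \in J -> [disjoint H k & \bigcup_(l in ~: J) H l].
      move=> kJ; apply/bigcup_disjointP => l; rewrite inE => lJ; apply: dj.
      by apply: contraNneq lJ => <-.
    by rewrite !dk.
  apply: (even_orientable_odd_only (v := v)); first exact: dj.
    by apply: (oH i).2.
  by apply: (oH j).2.
move=> nex; exists J; split=> // e /bigcupP[i iJ ei].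
have dE v : 0 < edeg (H i) v -> edeg (\bigcup_(j in J) H j) v = edeg (H i) v.
  move=> vi; apply: eq_card => f; rewrite !inE; apply/andP/andP => [[/bigcupP[j jJ fj] vf]|[fi vf]].
    split=> //; case: (i =P j) => [->//|/eqP ij].
    case/negP: nex; apply/existsP; exists i; rewrite iJ; apply/existsP; exists j; rewrite jJ ij /=.
    by apply/existsP; exists v; rewrite vi; apply/card_gt0P; exists f; rewrite inE fj.
  by split=> //; apply/bigcupP; exists i.
rewrite !dE; first by apply: (oH i).1.
  by apply/card_gt0P; exists e; rewrite inE ei inc_tgt.
by apply/card_gt0P; exists e; rewrite inE ei inc_src.
Qed.

Theorem decomposable_split (C : finType) (c : E -> C) :
  (forall a, li_edges [set e | c e == a]) ->
  exists H : {set E}, li_edges H /\ even_orientable (~: H).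
Proof.
move=> li; have [E0|[e0 _]] := set_0Vmem [set: E].
  have ET (X : {set E}) : X = set0 by apply/setP => e; have := in_setT e; rewrite E0 inE.
  by exists set0; split=> [e|]; rewrite ?inE // [~: _]ET; apply: even_orientable0.
have [Ro RoP] := fin_all_exists (fun a => forest_exists src tgt e0 [set e | c e == a]).
have [Rk RkP] := fin_all_exists RoP; have [Pe PeP] := fin_all_exists RkP.
(* Components of color classes are indexed by color and root; the other pairs yield empty sets. *)
pose K (i : C * V) := [set e in [set e | c e == i.1] | Ro i.1 (src e) == i.2].
have [H HP] := fin_all_exists (fun i : C * V => component_split i.2 (PeP i.1) (li i.1)).
have KP e i : (e \in K i) = (i == (c e, Ro (c e) (src e))).
  case: i => a r; rewrite !inE /= xpair_eqE [a == _]eq_sym [r == _]eq_sym.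
  by case: (c e =P a) => //= ->.
have dK i j : i != j -> [disjoint K i & K j].
  move=> ij; rewrite -setI_eq0; apply/eqP/setP => e; rewrite in_setI !KP in_set0.
  by apply/negbTE/negP => /andP[/eqP ei /eqP ej]; rewrite ei ej eqxx in ij.
have sH i : H i \subset K i by have [] := HP i.
have dH i j : i != j -> [disjoint H i & H j].
  by move=> /dK; apply: disjointW; apply: sH.
pose W := \bigcup_i (K i :\: H i).
have djW i : [disjoint H i & W].
  apply/bigcup_disjointP => j _; case: (eqVneq i j) => [<-|/dK].
    by (rewrite -setI_eq0; apply/eqP/setP => e; rewrite !in_setI !in_setD in_set0; case: (e \in H i)).
  by apply: disjointW; rewrite ?sH ?subsetDl.
have [i||J [liJ evJ]] := @odd_pieces_merge _ H W dH djW _ [set: C * V].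
- by have [] := HP i.
- rewrite setCT big_set0 setU0; apply: even_orientable_bigcup => [i j /dK|i].
    by apply: disjointW; apply: subsetDl.
  by have [] := HP i.
exists (\bigcup_(i in J) H i); split=> //; congr (even_orientable _): evJ.
apply/setP => e; rewrite in_setU in_setC; pose i := (c e, Ro (c e) (src e)).
have eK : e \in K i by rewrite KP.
have onlyi j : e \in H j -> j = i by move/(subsetP (sH j)); rewrite KP => /eqP.
apply/orP/idP => [[/bigcupP[j _]|/bigcupP[j]]|].
- rewrite inE => /andP[nH eKj]; apply/bigcupP => -[k _ ek]; case/negP: nH.
  by move: eKj; rewrite KP -/i => /eqP ->; rewrite -(onlyi _ ek).
- rewrite inE => jJ ej; apply/bigcupP => -[k kJ ek]; case/negP: jJ.
  by rewrite (onlyi _ ej) -(onlyi _ ek).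
case eH: (e \in H i) => nJ; last first.
  by left; apply/bigcupP; exists i; rewrite // inE eH.
right; apply/bigcupP; exists i => //; rewrite inE; apply: contra nJ => iJ.
by apply/bigcupP; exists i.
Qed.

End Decomposable.

(** * A locally irregular graph containing all edges inside the classes *)

Lemma greedy_fresh n (f : nat -> nat) (s : seq nat) : injective f -> size s < n ->
  exists2 i, i < n & f i \notin s.
Proof.
move=> inj ss; have : ~~ all (mem s) (map f (iota 0 n)).
  apply/negP => /allP sub; have := uniq_leq_size _ sub.
  by rewrite map_inj_uniq ?iota_uniq // size_map size_iota leqNgt ss => /(_ isT).
rewrite -has_predC => /hasP[x /mapP[i]]; rewrite mem_iota add0n => /andP[_ i_n] -> /= nin.
by exists i.
Qed.

Section LocalCut.

Variables (V E : finType) (src tgt : E -> V).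
Local Notation edeg := (edeg src tgt).
Local Notation inc := (inc src tgt).
Local Notation other := (other src tgt).
Local Notation li_edges := (li_edges src tgt).
Hypothesis ll : forall e, src e != tgt e.
Hypothesis simp : simple_edges src tgt.

(** In a labeling with the fewest edges inside classes, relabeling [v] gains nothing, so its own
    label is a least frequent one among the other ends of its edges. *)
Lemma local_cut (L : finType) (l0 : L) (F : {set E}) : exists l : V -> L,
  forall v, #|L| * edeg [set e in F | l (src e) == l (tgt e)] v <= edeg F v.
Proof.
pose mono (l : {ffun V -> L}) := #|[set e in F | l (src e) == l (tgt e)]|.
case: (@arg_minnP _ [ffun=> l0] predT mono erefl) => l _ lmin; exists l => v.
pose own k := #|[set e in [set e in F | inc v e] | l (other v e) == k]|.
have ownE : edeg [set e in F | l (src e) == l (tgt e)] v = own (l v).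
  apply: eq_card => e; rewrite !inE -!andbA; case: (e \in F) => //=; rewrite andbC.
  rewrite /inc /other; case: (v =P src e) => [->|_] /=; first by rewrite eq_sym.
  by case: (v =P tgt e) => [->|].
have -> : edeg F v = \sum_k own k.
  by rewrite -(card_partition_sum [set e in F | inc v e] (fun e => l (other v e)) predT);
    apply: eq_card => e; rewrite !inE andbT.
rewrite ownE -sum_nat_const; apply: leq_sum => k _.
pose l' := [ffun u => if u == v then k else l u].
pose rest := #|[set e in F | ~~ inc v e && (l (src e) == l (tgt e))]|.
have split (m : {ffun V -> L}) k' : (forall u, u != v -> m u = l u) -> m v = k' ->
    mono m = own k' + rest.
  move=> ml mv; rewrite /mono -(cardsID [set e | inc v e]); congr (_ + _).
    apply: eq_card => e; rewrite !inE -!andbA; case: (e \in F) => //=.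
    case ie: (inc v e); rewrite ?andbF //= andbT.
    have := other_neq (ll e) ie; move: ie; rewrite /inc /other.
    by case: (v =P src e) => [<- _ /ml ->|_ /= /eqP <- /ml ->]; rewrite mv.
  apply: eq_card => e; rewrite !inE; case ie: (inc v e) => /=; first by rewrite andbF.
  move: ie; rewrite /inc; case: (v =P src e) => //= /eqP vs /negbT vt.
  by rewrite !ml // eq_sym.
have := lmin l' isT; rewrite (split l (l v)) // (split l' k) ?leq_add2r //.
  by move=> u uv; rewrite ffunE (negbTE uv).
by rewrite ffunE eqxx.
Qed.

(** Vertices are treated one at a time, and each edge at [v] forbids the two values at its other
    end. *)
Lemma greedy_pairs (F : {set E}) (P Q : V -> nat -> Prop) :
  (forall v s, size s <= 2 * edeg F v -> exists2 x, P v x & x \notin s) ->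
  (forall v s, size s <= 2 * edeg F v -> exists2 x, Q v x & x \notin s) ->
  exists p q : V -> nat, (forall v, P v (p v) /\ Q v (q v)) /\
    {in F, forall e, [/\ p (src e) != p (tgt e), p (src e) != q (tgt e),
                         q (src e) != p (tgt e) & q (src e) != q (tgt e)]}.
Proof.
move=> freeP freeQ.
suff [p [q [pqP pqF]]] : exists p q : V -> nat,
    (forall v, v \in enum V -> P v (p v) /\ Q v (q v)) /\
    {in F, forall e, src e \in enum V -> tgt e \in enum V ->
      [/\ p (src e) != p (tgt e), p (src e) != q (tgt e),
          q (src e) != p (tgt e) & q (src e) != q (tgt e)]}.
  by exists p, q; split=> [v|e eF]; [apply: pqP | apply: pqF]; rewrite ?mem_enum.
elim: (enum V) => [|v s [p [q [pqP pqF]]]]; first by exists (fun=> 0), (fun=> 0); split.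
pose nb := enum [set e in F | inc v e].
pose forb := [seq p (other v e) | e <- nb] ++ [seq q (other v e) | e <- nb].
have sz : size forb <= 2 * edeg F v.
  by rewrite size_cat !size_map /nb -cardE addnn mul2n.
have [x Px xf] := freeP _ _ sz; have [y Qy yf] := freeQ _ _ sz.
have forbE e : e \in F -> inc v e ->
    p (other v e) \in forb /\ q (other v e) \in forb.
  move=> eF ie; have en : e \in nb by rewrite mem_enum inE eF.
  by rewrite !mem_cat; split; apply/orP; [left|right]; apply/mapP; exists e.
exists (fun u => if u == v then x else p u), (fun u => if u == v then y else q u).
split=> [u|e eF]; rewrite !inE; first by case: eqP => [->|_ /= /pqP].
have n1 z t : z \notin forb -> t \in forb -> z != t /\ t != z.
  by move=> zn tf; split; [|rewrite eq_sym]; apply: contraNneq zn => ->.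
case: (src e =P v) => [sv|sv] /=; case: (tgt e =P v) => [tv|tv] /=; last first.
- exact: pqF.
- move=> _ _; have ie : inc v e by rewrite -tv inc_tgt.
  have [] := forbE _ eF ie; rewrite /other -tv eq_sym (negbTE (ll e)) => f1 f2.
  by split; [have [] := n1 _ _ xf f1|have [] := n1 _ _ yf f1|have [] := n1 _ _ xf f2|have [] := n1 _ _ yf f2].
- move=> _ _; have ie : inc v e by rewrite -sv inc_src.
  have [] := forbE _ eF ie; rewrite /other -sv eqxx => f1 f2.
  by split; [have [] := n1 _ _ xf f1|have [] := n1 _ _ xf f2|have [] := n1 _ _ yf f1|have [] := n1 _ _ yf f2].
- by have := ll e; rewrite sv tv eqxx.
Qed.

Lemma window_fresh a b r h (s : seq nat) : size s <= 2 * h -> a + 3 + 8 * h <= b -> r < 4 ->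
  exists2 x, [/\ a <= x, x <= b & x %% 4 = r] & x \notin s.
Proof.
move=> ss ab r4.
(* The least number from [a] on with residue [r], since [r + 3 * a] is [r - a] modulo 4. Of
   [2 * h + 1] candidates in steps of 4, at most [2 * h] are excluded. *)
pose x0 := a + (r + 3 * a) %% 4.
have [|i ih nin] := @greedy_fresh (2 * h).+1 (fun i => x0 + 4 * i) s _ ss.
  by move=> i j /addnI/eqP; rewrite eqn_mul2l => /eqP.
exists (x0 + 4 * i) => //; split.
- by rewrite /x0; clear; lia.
- have := ltn_pmod (r + 3 * a) (isT : 0 < 4); move: ih ab; rewrite /x0; clear; lia.
- by rewrite /x0; move: r4; clear; lia.
Qed.

(* [R] consists of all edges inside the classes of [l] and of some of the edges between the two
   sides. Its degrees are 0 or 1 mod 4 on one side and 2 or 3 mod 4 on the other, except at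
   vertices of degree at most 23, and the value mod 4 leaves enough choices to make the degrees of
   neighbors inside a class different, because every vertex has at least 72 times as many
   neighbors across as inside its class. *)
Theorem irregular_core (F : {set E}) : exists (R : {set E}) (l : V -> bool * 'I_72),
  [/\ R \subset F, li_edges R,
      {in F :\: R, forall e, l (src e) != l (tgt e)} &
      {in R, forall e, exists2 v, inc v e & 2 < edeg (F :\: R) v}].
Proof.
have [s sP] := local_cut true F.
pose Fs := [set e in F | s (src e) == s (tgt e)].
pose F' := F :\: Fs.
have sFs : Fs \subset F by apply/subsetP => e; rewrite inE => /andP[].
have [c cP] := local_cut (ord0 : 'I_72) Fs.
pose I := [set e in Fs | c (src e) == c (tgt e)].
pose h v := edeg I v.
(* A vertex with edges inside its class keeps all its crossing edges in [P]. *)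
pose P := [set e in F' | (0 < h (src e)) || (0 < h (tgt e))].
pose D v := edeg P v.
have sPF : P \subset F' by apply/subsetP => e; rewrite inE => /andP[].
(* At most half of the edges at [v] stay on its side, and at most one in 72 of those stays in its
   class. *)
have hD v : 72 * h v <= D v.
  case: (posnP (h v)) => [->//|hv].
  have -> : D v = edeg F' v.
    apply: eq_card => e; rewrite !inE; case iv: (inc v e); rewrite ?andbF // !andbT.
    by case/orP: iv => /eqP <-; rewrite hv ?orbT ?andbT.
  have := sP v; have := cP v; rewrite card_ord card_bool -/Fs -/I -/(h v) (edegD src tgt v sFs) -/F'.
  by clear; lia.
pose big v := 23 < D v.
pose res v := if s v then 2 else 0.
have res4 v : res v < 4 by rewrite /res; case: (s v).
(* The targets count the [h v] edges inside the class. Bounds at a third, a half and two thirds of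
   [D v] yield the hypotheses of [degree_constrained]. The window length, about [D v / 6] and thus
   about [12 * h v] or more, exceeds the [3 + 8 * h v] of [window_fresh]; [big] covers [h v = 0]. *)
pose Plo v x := big v -> [/\ (D v + 2) %/ 3 + h v <= x, x <= D v %/ 2 + h v & x %% 4 = res v].
pose Phi v x := big v -> [/\ (D v + 1) %/ 2 + h v <= x, x <= (2 * D v) %/ 3 + h v & x %% 4 = res v].
have small_fresh (t : seq nat) : exists x, x \notin t.
  by have [i _ it] := @greedy_fresh _ id t (fun _ _ => id) (ltnSn _); exists i.
have freeP v (t : seq nat) : size t <= 2 * edeg I v -> exists2 x, Plo v x & x \notin t.
  move=> st; case: (boolP (big v)) => bv; last first.
    by have [x xt] := small_fresh t; exists x => // /(negP bv).
  have [|x [x1 x2 x3] xt] := @window_fresh ((D v + 2) %/ 3 + h v) (D v %/ 2 + h v) _ (h v) _ st _ (res4 v).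
    by move: bv (hD v); rewrite /big; clear; lia.
  by exists x.
have freeQ v (t : seq nat) : size t <= 2 * edeg I v -> exists2 x, Phi v x & x \notin t.
  move=> st; case: (boolP (big v)) => bv; last first.
    by have [x xt] := small_fresh t; exists x => // /(negP bv).
  have [|x [x1 x2 x3] xt] := @window_fresh ((D v + 1) %/ 2 + h v) ((2 * D v) %/ 3 + h v) _ (h v) _ st _ (res4 v).
    by move: bv (hD v); rewrite /big; clear; lia.
  by exists x.
have [p [q [pq pqI]]] := greedy_pairs freeP freeQ.
pose lo v := if big v then p v - h v else D v %/ 2.
pose hi v := if big v then q v - h v else D v %/ 2.
have lohi v : [/\ lo v * 2 <= D v, D v <= hi v * 2 + 2, lo v <= hi v,
    hi v <= lo v * 2 + 3 & hi v * 2 <= D v + lo v + 2].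
  rewrite /lo /hi; case: ifP => bv; last by clear; split; lia.
  have [/(_ bv)[p1 p2 _] /(_ bv)[q1 q2 _]] := pq v.
  by move: p1 p2 q1 q2; clear; split; lia.
have bip : {in P, forall e, s (src e) != s (tgt e)}.
  by move=> e /(subsetP sPF); rewrite !inE => /andP[]; case: (e \in F).
have [R [sRP RP]] := @degree_constrained V E src tgt simp s P bip lo hi
  (fun v => let: And5 h1 _ _ _ _ := lohi v in h1)
  (fun v => let: And5 _ h1 _ _ _ := lohi v in h1)
  (fun v => let: And5 _ _ h1 _ _ := lohi v in h1)
  (fun v => let: And5 _ _ _ h1 _ := lohi v in h1)
  (fun v => let: And5 _ _ _ _ h1 := lohi v in h1).
have sIF : I \subset Fs by apply/subsetP => e; rewrite inE => /andP[].
have dIR : [disjoint I & R].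
  apply: (disjointW sIF (subset_trans sRP sPF)).
  by rewrite -setI_eq0; apply/eqP/setP => e; rewrite in_setI in_setD in_set0; case: (e \in Fs).
have dE v : edeg (I :|: R) v = h v + edeg R v by rewrite edegU.
have bigE v : big v -> exists2 g, edeg (I :|: R) v = g \/ edeg (I :|: R) v = g.+1 &
    (g = p v \/ g = q v) /\ g %% 4 = res v.
  move=> bv; have [/(_ bv)[p1 p2 p3] /(_ bv)[q1 q2 q3]] := pq v.
  have := RP v; rewrite dE !inE /lo /hi bv => /or4P[] /eqP ->.
  - by exists (p v); [left; move: p1; clear; lia | split; [left|]].
  - by exists (p v); [right; move: p1; clear; lia | split; [left|]].
  - by exists (q v); [left; move: q1; clear; lia | split; [right|]].
  - by exists (q v); [right; move: q1; clear; lia | split; [right|]].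
have hbig v : 0 < h v -> big v /\ 25 <= edeg (I :|: R) v.
  move=> hv; have bv : big v by move: (hD v) hv; rewrite /big; clear; lia.
  split=> //; have [/(_ bv)[p1 p2 p3] /(_ bv)[q1 q2 q3]] := pq v.
  have [g ge [gpq _]] := bigE _ bv; move: hv (hD v) p1 q1.
  by case: ge => ->; case: gpq => ->; clear; lia.
have actI e : e \in I -> 0 < h (src e) /\ 0 < h (tgt e).
  by move=> eI; split; apply/card_gt0P; exists e; rewrite inE eI ?inc_src ?inc_tgt.
(* [R] uses at most two thirds of the edges of [P] at [v], plus one; the remaining ones supply the
   3-stars that repair parities. *)
have spare v : 0 < h v -> 2 < edeg (F :\: (I :|: R)) v.
  move=> hv; have [bv _] := hbig _ hv.
  have : edeg (P :\: R) v <= edeg (F :\: (I :|: R)) v.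
    apply: edegS; apply/subsetP => e; rewrite !in_setD in_setU negb_or => /andP[-> eP].
    have := subsetP sPF _ eP; rewrite in_setD => /andP[eFs ->]; rewrite !andbT.
    by apply: contra eFs; apply: (subsetP sIF).
  apply: leq_trans; have := edegD src tgt v sRP; rewrite -/(D v).
  have [/(_ bv)[p1 p2 p3] /(_ bv)[q1 q2 q3]] := pq v.
  have := RP v; rewrite !inE /lo /hi bv; move: bv (hD v) hv p1 p2 q1 q2; rewrite /big; clear.
  by move=> b1 b2 b3 b4 b5 b6 b7 /or4P[] /eqP ->; lia.
exists (I :|: R), (fun v => (s v, c v)); split.
- apply/subsetP => e; rewrite in_setU => /orP[/(subsetP sIF)/(subsetP sFs)//|/(subsetP sRP)].
  by move/(subsetP sPF); rewrite in_setD => /andP[].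
- move=> e; rewrite in_setU => /orP[eI|eR].
    have [h1 h2] := actI _ eI; have [b1 _] := hbig _ h1; have [b2 _] := hbig _ h2.
    have [g1 e1 [pq1 r1]] := bigE _ b1; have [g2 e2 [pq2 r2]] := bigE _ b2.
    have g12 : g1 != g2.
      by have [] := pqI _ eI; case: pq1 => ->; case: pq2 => ->.
    have s12 : s (src e) = s (tgt e).
      by have := subsetP sIF _ eI; rewrite inE => /andP[_ /eqP].
    have {r1 r2}r12 : g1 %% 4 = g2 %% 4 by rewrite r1 r2 /res s12.
    (* Distinct numbers that agree modulo 4 differ by at least 4, so raising either by one keeps
       them distinct. *)
    by apply/eqP; case: e1 => ->; case: e2 => ->; move: g12 r12; clear => /eqP; lia.
  have eP := subsetP sRP _ eR; have se := bip _ eP.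
  have actP : 0 < h (src e) \/ 0 < h (tgt e) by move: eP; rewrite inE => /andP[_ /orP].
  (* If one end of [e] is small, the other has edges inside its class and hence degree at least
     25. *)
  have sm v : inc v e -> ~~ big v -> edeg (I :|: R) v <= 23.
    move=> iv bv; rewrite dE (_ : h v = 0).
      apply: leq_trans (edegS _ _ v sRP) _; by rewrite leqNgt.
    by apply/eqP; rewrite -leqn0 leqNgt; apply: contra bv => /hbig[].
  case: (boolP (big (src e))) => b1; last first.
    case: actP => [/hbig[b]|/hbig[_]]; first by rewrite b in b1.
    by have := sm _ (inc_src src tgt e) b1; clear; lia.
  case: (boolP (big (tgt e))) => b2; last first.
    case: actP => [/hbig[_]|/hbig[b]]; last by rewrite b in b2.
    by have := sm _ (inc_tgt src tgt e) b2; clear; lia.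
  have [g1 e1 [_ r1]] := bigE _ b1; have [g2 e2 [_ r2]] := bigE _ b2.
  move: r1 r2 se; rewrite /res; case: (s _); case: (s _) => // r1 r2 _;
    by apply/eqP; case: e1 => ->; case: e2 => ->; move: r1 r2; clear; lia.
- move=> e; rewrite in_setD in_setU negb_or => /andP[/andP[eI _] eF].
  by apply: contra eI => /eqP[se ce]; rewrite !inE eF se ce !eqxx.
- move=> e; rewrite in_setU => /orP[/actI[h1 _]|/(subsetP sRP)].
    by exists (src e); [apply: inc_src | apply: spare].
  rewrite inE => /andP[_ /orP[h1|h1]].
    by exists (src e); [apply: inc_src | apply: spare].
  by exists (tgt e); [apply: inc_tgt | apply: spare].
Qed.

End LocalCut.

(** * Assembling the coloring *)

Section CoverFree.

(* The twelve lines of the affine plane of order 3, on the points 0, ..., 8. *)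
Definition line (i : nat) : seq nat :=
  nth [::] [:: [:: 0; 1; 2]; [:: 3; 4; 5]; [:: 6; 7; 8]; [:: 0; 3; 6]; [:: 1; 4; 7]; [:: 2; 5; 8];
    [:: 0; 4; 8]; [:: 2; 3; 7]; [:: 1; 5; 6]; [:: 0; 5; 7]; [:: 1; 3; 8]; [:: 2; 4; 6]] i.

(* Two lines meet in at most one point, so no line is covered by two others. *)
Lemma line_not_covered i j k : i < 12 -> j < 12 -> k < 12 -> i != j -> i != k ->
  exists2 p, p < 9 & [/\ p \in line i, p \notin line j & p \notin line k].
Proof.
have : all (fun i => all (fun j => all (fun k => (i == j) || (i == k) ||
    has (fun p => [&& p \in line i, p \notin line j & p \notin line k]) (iota 0 9))
    (iota 0 12)) (iota 0 12)) (iota 0 12) by vm_compute.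
move=> /allP H i12 j12 k12 /negbTE nij /negbTE nik.
have /H/allP/(_ j) : i \in iota 0 12 by rewrite mem_iota.
rewrite mem_iota => /(_ j12)/allP/(_ k); rewrite mem_iota => /(_ k12).
by rewrite nij nik !orFb => /hasP[p]; rewrite mem_iota => p9 /and3P[]; exists p.
Qed.

(** A code of length 3 over 12 letters: the two digits of [n] in base 12 and their sum modulo 12 as
    a check digit. *)
Definition coordinate (j n : nat) : nat :=
  match j with 0 => n %/ 12 | 1 => n %% 12 | _ => (n %/ 12 + n %% 12) %% 12 end.

Lemma coordinate_neq2 n m : n < 144 -> m < 144 -> n != m ->
  [/\ coordinate 0 n == coordinate 0 m -> coordinate 1 n != coordinate 1 m,
      coordinate 0 n == coordinate 0 m -> coordinate 2 n != coordinate 2 m &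
      coordinate 1 n == coordinate 1 m -> coordinate 2 n != coordinate 2 m].
Proof. by move=> n1 m1 /eqP nm; rewrite /coordinate; split=> /eqP e; apply/eqP; lia. Qed.

(** [y] and [z] each agree with [x] in at most one of the three coordinates, so one coordinate
    separates [x] from both. There the line of [x] has a point off the lines of [y] and [z]. *)
Lemma cover_free : exists A : 'I_3 * 'I_9 -> pred (bool * 'I_72),
  forall x y z, x != y -> x != z -> exists i, [/\ A i x, ~~ A i y & ~~ A i z].
Proof.
pose code (x : bool * 'I_72) := x.1 * 72 + x.2.
have code144 x : code x < 144.
  by case: x => [[] [i i72]]; rewrite /code /=; move: i72; clear; lia.
have code_inj x y : x != y -> code x != code y.
  case: x y => [a i] [b j]; apply: contraNneq; rewrite /code /= => eqc.
  have := ltn_ord i; have := ltn_ord j => j72 i72.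
  have eab : a = b by case: a b eqc => [] [] //; move: i72 j72; clear; lia.
  by rewrite eab in eqc *; rewrite xpair_eqE eqxx; apply/eqP/val_inj/(addnI eqc).
have coord12 j n : n < 144 -> coordinate j n < 12.
  by case: j => [|[|j]] /=; clear; lia.
exists (fun (i : 'I_3 * 'I_9) x => (i.2 : nat) \in line (coordinate i.1 (code x))) => x y z /code_inj nxy /code_inj nxz.
have [j nj1 nj2] : exists2 j : 'I_3, coordinate j (code x) != coordinate j (code y) &
    coordinate j (code x) != coordinate j (code z).
  have [y1 y2 y3] := coordinate_neq2 (code144 x) (code144 y) nxy.
  have [z1 z2 z3] := coordinate_neq2 (code144 x) (code144 z) nxz.
  case: (boolP (coordinate 0 (code x) == coordinate 0 (code y))) => y0.
    case: (boolP (coordinate 1 (code x) == coordinate 1 (code z))) => z1'.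
      by exists (@Ordinal 3 2 isT); [apply: y2 | apply: z3].
    by exists (@Ordinal 3 1 isT); [apply: y1 | apply: z1'].
  case: (boolP (coordinate 0 (code x) == coordinate 0 (code z))) => z0.
    case: (boolP (coordinate 1 (code x) == coordinate 1 (code y))) => y1'.
      by exists (@Ordinal 3 2 isT); [apply: y3 | apply: z2].
    by exists (@Ordinal 3 1 isT); [apply: y1' | apply: z1].
  by exists (@Ordinal 3 0 isT).
have [p p9 [px py pz]] := line_not_covered (coord12 j _ (code144 x)) (coord12 j _ (code144 y))
  (coord12 j _ (code144 z)) nj1 nj2.
by exists (j, Ordinal p9).
Qed.

End CoverFree.

Section Assembly.

Variables (V E : finType) (src tgt : E -> V).
Local Notation edeg := (edeg src tgt).
Local Notation inc := (inc src tgt).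
Local Notation other := (other src tgt).
Local Notation li_edges := (li_edges src tgt).
Local Notation li_edge_colorable := (li_edge_colorable src tgt).
Hypothesis ll : forall e, src e != tgt e.
Hypothesis simp : simple_edges src tgt.
Let llW (W : {set E}) : loopless src tgt W. Proof. by move=> e _; apply: ll. Qed.

Lemma li_star (S : {set E}) v : {in S, forall e, inc v e} -> 1 < #|S| -> li_edges S.
Proof.
move=> vS cS e eS; have dv : edeg S v = #|S|.
  by apply: eq_card => f; rewrite inE; apply: andb_idr; apply: vS.
have du u : u != v -> edeg S u <= 1 by move=> uv; apply: edeg_star simp uv vS.
have := ll e; have := vS _ eS; rewrite /inc => /orP[] /eqP ve; rewrite -ve.
  by rewrite eq_sym => /du; rewrite dv; move: cS; clear => a b; apply/eqP; lia.
by move=> /du; rewrite dv; move: cS; clear => a b; apply/eqP; lia.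
Qed.

(** Only roots may have odd outdegree, and each such root gives up one outgoing edge to [L]. These
    edges join a root to a non-root, so [m] marks the roots. *)
Lemma even_orientable_near (W : {set E}) (e0 : E) : exists (L : {set E}) (m : V -> bool) (o : E -> V),
  [/\ L \subset W, {in L, forall e, m (src e) != m (tgt e)}, forall e, inc (o e) e &
      forall v, ~~ odd (outdeg (W :\: L) o v)].
Proof.
have [root [rk [pe fo]]] := forest_exists src tgt e0 W.
have [|o [io oP]] := @orientation _ _ _ _ _ _ _ _ fo (@llW W) (fun v => root v != v) W (fun=> false) (subxx _).
  by move=> v rv; split=> //; have [] := forest_pe fo rv.
have [l lP] : exists l : V -> E, forall v, odd (outdeg W o v) -> l v \in W /\ o (l v) = v.
  pose lP v e := odd (outdeg W o v) -> e \in W /\ o e = v.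
  apply: (@fin_all_exists V (fun=> E) lP) => v; rewrite /lP.
  case od: (odd _); last by exists e0.
  have : 0 < outdeg W o v by case: (outdeg _ _ _) od.
  by case/card_gt0P => e; rewrite inE => /andP[eW /eqP oe]; exists e.
pose B := [set v | odd (outdeg W o v)].
have rootB v : v \in B -> root v = v.
  by rewrite inE => od; apply/eqP/negPn/negP => /oP; rewrite od.
have lB v : v \in B -> l v \in W /\ o (l v) = v by rewrite inE; apply: lP.
have sL : l @: B \subset W by apply/subsetP => e /imsetP[v /lB[lW _] ->].
exists (l @: B), (fun v => root v == v), o; split=> // [e /imsetP[v vB ->]|v].
  have [lW ol] := lB _ vB; have iv : inc v (l v) by rewrite -{1}ol io.
  have re := forest_edge fo lW; have := ll (l v); have rv := rootB _ vB.
  move: iv; rewrite /inc => /orP[] /eqP ve.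
    by rewrite -re -ve rv eqxx => /negbTE ->.
  by rewrite re -ve rv eqxx [v == _]eq_sym => /negbTE ->.
have := congr1 odd (outdegD o v sL); rewrite oddD.
suff -> : outdeg (l @: B) o v = (v \in B).
  by rewrite oddb inE; case: (odd (outdeg W o v)); case: (odd _).
rewrite /outdeg; case vB: (v \in B).
  rewrite /nat_of_bool -(cards1 (l v)); apply: eq_card => e; rewrite !inE.
  apply/andP/eqP => [[/imsetP[u uB ->] /eqP]|->].
    by have [_ ->] := lB _ uB => ->.
  by split; [apply: imset_f | have [_ ->] := lB _ vB].
apply/eqP; rewrite cards_eq0; apply/eqP/setP => e; rewrite !inE.
apply/negbTE/negP => /andP[/imsetP[u uB ->]]; have [_ ->] := lB _ uB => /eqP uv.
by rewrite -uv uB in vB.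
Qed.

(** Each component with an odd number of edges of [R] gets a star of three edges at a vertex
    supplied by the last hypothesis; stars in different components do not meet. *)
Lemma component_stars (P W R : {set E}) root rk pe : forest src tgt P root rk pe ->
  W \subset P -> R \subset P ->
  {in R, forall e, exists2 v, inc v e & 2 < edeg W v} ->
  exists S : {set E}, [/\ S \subset W, li_edges S & forall r,
    odd #|[set e in S | root (src e) == r]| = odd #|[set e in R | root (src e) == r]|].
Proof.
move=> fo sWP sRP RW.
pose Q r (S : {set E}) := [/\ S \subset [set e in W | root (src e) == r],
  odd #|S| = odd #|[set e in R | root (src e) == r]| & li_edges S].
have [S SQ] : exists S, forall r, Q r (S r).
  apply: (@fin_all_exists V (fun=> {set E}) Q) => r.
  case od: (odd #|[set e in R | root (src e) == r]|); last first.
    exists set0; split; rewrite ?sub0set ?cards0 ?od //.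
    by move=> e; rewrite inE.
  have [e] : exists e, e \in [set e in R | root (src e) == r].
    by apply/card_gt0P; case: #|_| od.
  rewrite inE => /andP[eR /eqP re]; have [v ve dv] := RW _ eR.
  have [S sS cS] := exists_subset_card dv.
  have SP f : f \in S -> f \in W /\ inc v f by move/(subsetP sS); rewrite inE => /andP.
  exists S; split.
  - apply/subsetP => f /SP[fW vf]; rewrite inE fW /=.
    rewrite -(forest_inc fo (subsetP sWP _ fW) vf) -re.
    by rewrite (forest_inc fo (subsetP sRP _ eR) ve).
  - by rewrite cS od.
  - by apply: (@li_star S v); rewrite ?cS // => f /SP[].
have rS r e : e \in S r -> e \in W /\ root (src e) = r.
  by have [sS _ _] := SQ r; move/(subsetP sS); rewrite inE => /andP[-> /eqP].
have memS e : (e \in \bigcup_r S r) = (e \in S (root (src e))).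
  apply/bigcupP/idP => [[r _ er]|er]; last by exists (root (src e)).
  by have [_ ->] := rS _ _ er.
exists (\bigcup_r S r); split.
- by apply/bigcupsP => r _; apply/subsetP => e /rS[].
- move=> e; rewrite memS => eS; have [eW _] := rS _ _ eS.
  have dE v : inc v e -> edeg (\bigcup_r S r) v = edeg (S (root (src e))) v.
    move=> ve; apply: eq_card => f; rewrite [LHS]inE [RHS]inE memS.
    case vf: (inc v f); rewrite ?andbF // !andbT.
    have rv := forest_inc fo (subsetP sWP _ eW) ve.
    case fW: (f \in W); first by rewrite -(forest_inc fo (subsetP sWP _ fW) vf) rv.
    by apply/idP/idP => /rS[]; rewrite fW.
  by rewrite !dE ?inc_src ?inc_tgt //; have [_ _] := SQ (root (src e)); apply.
- move=> r; have [sS <- _] := SQ r; congr (odd _); apply: eq_card => e.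
  rewrite inE memS; case: (root (src e) =P r) => [->|ne]; first by rewrite andbT.
  by rewrite andbF; apply/esym/negbTE/negP => /rS[].
Qed.

(* 220 = 1 + 1 + 1 + 7 * 27 + 7 * 4: one color for each of [H], [R] and [S], seven for each of
   the 27 sets of [cover_free] and seven for each of the four labels on [T :|: L]. *)
Theorem li_edge_colorable_220 (C : finType) (c : E -> C) :
  (forall a, li_edges [set e | c e == a]) -> li_edge_colorable 220 [set: E].
Proof.
move=> li; have [->|[e0 _]] := set_0Vmem [set: E]; first exact: li_edge_colorable0.
have [H [liH [o [io evo]]]] := decomposable_split ll simp li.
set P := ~: H in evo.
have [root [rk [pe fo]]] := forest_exists src tgt e0 P.
pose T := pe @: [set v | root v != v].
have sTP : T \subset P by apply/subsetP => e /imsetP[v]; rewrite inE => /(forest_pe fo)[? _ _ _] ->.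
pose F := P :\: T.
have sFP : F \subset P by apply: subsetDl.
have [R [l [sRF liR lP RP]]] := irregular_core ll simp F.
pose W := F :\: R.
have sWF : W \subset F by apply: subsetDl.
have [S [sSW liS SP]] := component_stars fo (subset_trans sWF sFP) (subset_trans sRF sFP) RP.
have [L [m [o1 [sL mL io1 ev1]]]] := even_orientable_near (W :\: S) e0.
set W2 := (W :\: S) :\: L in ev1.
have sW2W : W2 \subset W by rewrite /W2 setDDl subsetDl.
have sW2P : W2 \subset P by apply: subset_trans sW2W (subset_trans sWF sFP).
have inR e : e \in R -> (e \in P) && (e \notin T).
  by move/(subsetP sRF); rewrite inE andbC.
have inS e : e \in S -> [&& e \in P, e \notin T & e \notin R].
  by move/(subsetP sSW); rewrite !in_setD => /and3P[-> -> ->].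
have inL e : e \in L -> [&& e \in P, e \notin T, e \notin R & e \notin S].
  by move/(subsetP sL); rewrite !in_setD => /and4P[-> -> -> ->].
have inT e : e \in T -> e \in P by apply: (subsetP sTP).
have inW2 e : (e \in W2) = [&& e \in P, e \notin T, e \notin R, e \notin S & e \notin L].
  by rewrite !in_setD; case: (e \in P); case: (e \in T); case: (e \in R); case: (e \in S); case: (e \in L).
pose TL := T :|: L.
have memP e : (e \in P) = (e \in R :|: (S :|: (W2 :|: TL))).
  rewrite !in_setU inW2; case eR: (e \in R); first by case/andP: (inR _ eR) => ->.
  case eS: (e \in S); first by case/and3P: (inS _ eS) => ->.
  case eT: (e \in T); first by rewrite inT // !orbT.
  case eL: (e \in L); first by case/and4P: (inL _ eL) => ->; rewrite !orbT.
  by rewrite !andbT !orbF.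
have disj (X Y : {set E}) : (forall e, e \in X -> e \notin Y) -> [disjoint X & Y].
  by move=> XY; rewrite disjoint_subset; apply/subsetP => e /XY.
have d1 : [disjoint R & S :|: (W2 :|: TL)].
  apply: disj => e eR; rewrite !in_setU inW2 eR !negb_or.
  case/andP: (inR _ eR) => _ ->; rewrite !andbF /=.
  apply/andP; split; first by apply/negP => /inS; rewrite eR !andbF.
  by apply/negP => /inL; rewrite eR !andbF.
have d2 : [disjoint S & W2 :|: TL].
  apply: disj => e eS; rewrite !in_setU inW2 eS !negb_or.
  case/and3P: (inS _ eS) => _ -> _; rewrite !andbF /=.
  by apply/negP => /inL; rewrite eS !andbF.
have d3 : [disjoint W2 & TL].
  by apply: disj => e; rewrite inW2 in_setU negb_or => /and5P[_ -> _ _ ->].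
have dHP : [disjoint H & P] by rewrite -setI_eq0 setICr.
have PE : P = R :|: (S :|: (W2 :|: TL)) by apply/setP.
have EE : [set: E] = H :|: P by rewrite setUCr.
pose cnt (X : {set E}) r := #|[set e in X | root (src e) == r]|.
have cntU (X Y : {set E}) r : [disjoint X & Y] -> cnt (X :|: Y) r = cnt X r + cnt Y r.
  move=> dXY; rewrite /cnt -cardsUI (_ : _ :&: _ = set0) ?cards0 ?addn0.
    by apply: eq_card => e; rewrite !inE andb_orl.
  apply/setP => e; rewrite in_setI in_set0 !in_set; apply/negbTE/negP.
  by case/andP=> /andP[eX _] /andP[eY _]; rewrite (disjointFr dXY) in eY.
have cnt_even (X : {set E}) (o' : E -> V) r : X \subset P -> (forall e, inc (o' e) e) ->
    (forall v, ~~ odd (outdeg X o' v)) -> ~~ odd (cnt X r).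
  move=> sXP io' ev'; rewrite /cnt (odd_outdeg_comp fo r sXP (fun e _ => io' e)).
  rewrite (_ : [set v | _] = set0) ?cards0 //; apply/setP => v.
  by rewrite !inE (negbTE (ev' v)) andbF.
(* In each component of [P] the number of edges is even for [P] and [W2], being even orientable, and
   for [R] and [S] together by the choice of [S]; hence also for [TL]. As [TL] contains the spanning
   forest, it is even orientable. *)
have cTL r : odd (cnt TL r) = false.
  have cP : cnt P r = cnt R r + (cnt S r + (cnt W2 r + cnt TL r)) by rewrite {1}PE (cntU _ _ _ d1) (cntU _ _ _ d2) (cntU _ _ _ d3).
  have := cnt_even _ _ r (subxx P) io evo; have /negbTE := cnt_even _ _ r sW2P io1 ev1.
  rewrite cP !oddD [odd (cnt S r)]SP -/(cnt R r) => ->.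
  by rewrite addbA addbb /= => /negbTE.
have sTLP : TL \subset P.
  by rewrite subUset sTP; apply/subsetP => e /inL/and4P[].
have [v rv _|r _|o2 [io2 ev2]] := @orientation_with_parity _ _ _ _ _ TL _ _ _ predT (fun=> false) fo
    (@llW P) sTLP _ (fun _ _ => isT) (fun _ _ => isT).
- by rewrite in_setU; apply/orP; left; apply: imset_f; rewrite inE.
- rewrite -/(cnt TL r) cTL (_ : [set v | _] = set0) ?cards0 //.
  by apply/setP => v; rewrite !inE andbF.
have colW2 : li_edge_colorable (7 * 27) W2.
  have [A AP] := cover_free.
  have -> : 7 * 27 = 7 * #|{: 'I_3 * 'I_9}| by rewrite card_prod !card_ord.
  apply: (cherry_coloring simp (ord0, ord0) (A := fun i v => A i (l v)) (@llW W2) io1 ev1).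
  move=> e f eW fW oef.
  have lo g : g \in W2 -> l (o1 g) != l (other (o1 g) g).
    move/(subsetP sW2W)/lP; have := io1 g; rewrite /inc /other.
    by case: (o1 g =P src g) => [->//|_ /= /eqP ->]; rewrite eq_sym.
  (* The tail of a cherry must be separated from both heads at once, hence a family in which no set
     is covered by two others. *)
  have [|i [i1 i2 i3]] := AP (l (o1 e)) (l (other (o1 e) e)) (l (other (o1 f) f)) (lo _ eW).
    by rewrite oef lo.
  by exists i.
have colTL : li_edge_colorable (7 * 4) TL.
  have -> : 7 * 4 = 7 * #|{: bool * bool}| by rewrite card_prod card_bool.
  (* The parity of the depth changes along each edge of [T], and [m] along each edge of [L]. *)
  pose lab v := (odd (rk v), m v).
  have labP e : e \in TL -> lab (src e) != lab (tgt e).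
    rewrite in_setU => /orP[/imsetP[v]|/mL]; last first.
      by apply: contraNneq => -[_ ->].
    rewrite inE => rv ->; have [_ iv _ rk1] := forest_pe fo rv.
    apply: contraTneq isT => -[eqr _]; move: iv rk1 eqr; rewrite /inc /other.
    case: (v =P src (pe v)) => [<- _ ->|_ /= /eqP <- ->] /=; last by case: (odd _).
    by case: (odd _).
  apply: (cherry_coloring simp (true, true) (A := fun i v => lab v == i) (@llW TL) io2).
    by move=> v; rewrite ev2.
  move=> e f eW fW oef; exists (lab (o2 e)).
  have lo g : g \in TL -> lab (other (o2 g) g) != lab (o2 g).
    move/labP; have := io2 g; rewrite /inc /other.
    by case: (o2 g =P src g) => [-> _|_ /= /eqP ->//]; rewrite eq_sym.
  by rewrite eqxx lo // oef lo.
rewrite EE -[220]/(1 + (1 + (1 + (7 * 27 + 7 * 4)))).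
apply: li_edge_colorableU dHP (li_edge_colorable1 liH) _.
rewrite PE; apply: li_edge_colorableU d1 (li_edge_colorable1 liR) _.
apply: li_edge_colorableU d2 (li_edge_colorable1 liS) _.
exact: li_edge_colorableU d3 colW2 colTL.
Qed.

End Assembly.

(** * From simple graphs to edges with two chosen ends *)

Section EdgeEnds.

Variables (G : sgraph) (src tgt : edge G -> G).
Hypothesis ends : forall f : edge G, adj (src f) (tgt f) /\ val f = [set src f; tgt f].

Lemma src_neq_tgt f : src f != tgt f.
Proof. by apply/eqP => e; have [] := ends f; rewrite e adj_irrefl. Qed.

Lemma inc_val u f : inc src tgt u f = (u \in val f).
Proof. by have [_ ->] := ends f; rewrite !inE. Qed.

Lemma val_pair u v f : u != v -> inc src tgt u f -> inc src tgt v f -> val f = [set u; v].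
Proof.
have [_ ->] := ends f; rewrite /inc.
by move=> uv /orP[] /eqP eu /orP[] /eqP ev; subst u v; rewrite ?eqxx // setUC in uv *.
Qed.

Lemma simple_ends : simple_edges src tgt.
Proof.
move=> e f u v uv ue ve uf vf; apply: val_inj.
by rewrite (val_pair uv ue ve) (val_pair uv uf vf).
Qed.

(** Degrees agree because [other] maps the edges of color [a] at [x] bijectively to the neighbors of
    [x] in the color class. *)
Lemma color_class_li (C : finType) (c : {ffun edge G -> C}) a :
  locally_irregular (color_class c a) <-> li_edges src tgt [set f | c f == a].
Proof.
set X := [set f | c f == a].
have degE (x : color_class c a) : deg x = edeg src tgt X x.
  rewrite /deg /edeg -(card_in_imset (f := other src tgt x)).
    apply: eq_card => y; rewrite inE; apply/existsP/imsetP => [[f /andP[/eqP fxy cf]]|[f]].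
      have xf : inc src tgt x f by rewrite inc_val fxy !inE eqxx.
      exists f; first by rewrite !inE cf.
      apply: other_eq => //; first by rewrite inc_val fxy !inE eqxx orbT.
      apply: contraTneq (src_neq_tgt f) => yx; rewrite negbK.
      have := inc_src src tgt f; have := inc_tgt src tgt f.
      by rewrite !inc_val fxy yx !inE !orbb => /eqP -> /eqP ->.
    rewrite !inE => /andP[cf xf] ->; exists f; rewrite cf andbT; apply/eqP/val_pair => //.
      by rewrite eq_sym other_neq // src_neq_tgt.
    exact: inc_other.
  move=> e f; rewrite !inE => /andP[_ xe] /andP[_ xf] oef.
  have xo : x != other src tgt x e by rewrite eq_sym other_neq // src_neq_tgt.
  by apply: (simple_ends xo); rewrite ?inc_other // oef inc_other.
split=> [/forallP li f fX|li].
  rewrite -!degE; have /forallP/(_ (tgt f))/implyP := li (src f); apply.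
  by apply/existsP; exists f; have [_ ->] := ends f; rewrite eqxx /=; rewrite inE in fX.
apply/forallP => x; apply/forallP => y; apply/implyP => /existsP[f /andP[/eqP fxy cf]].
have := li f; rewrite inE cf => /(_ isT); have [_ ef] := ends f; rewrite !degE.
have xf : inc src tgt x f by rewrite inc_val fxy !inE eqxx.
have yf : inc src tgt y f by rewrite inc_val fxy !inE eqxx orbT.
have : x != y.
  apply: contraTneq (src_neq_tgt f) => xy; rewrite negbK.
  have := inc_src src tgt f; have := inc_tgt src tgt f.
  by rewrite !inc_val fxy xy !inE !orbb => /eqP -> /eqP ->.
by move: xf yf; rewrite /inc => /orP[] /eqP -> /orP[] /eqP ->; rewrite ?eqxx // => _;
  rewrite eq_sym.
Qed.

End EdgeEnds.

Theorem theorem5 (G : sgraph) (decG : decomposable G) : chi_irr decG <= 220.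
Proof.
rewrite /chi_irr; case: ex_minnP => m _; apply.
have [k /existsP[c /forallP lic]] := decG.
have [p ends] : exists p : edge G -> G * G, forall f,
    adj (p f).1 (p f).2 /\ val f = [set (p f).1; (p f).2].
  pose Q (f : edge G) (q : G * G) := adj q.1 q.2 /\ val f = [set q.1; q.2].
  apply: (@fin_all_exists (edge G) (fun=> (G * G)%type) Q) => -[f fE].
  by case/imsetP: (fE) => q; rewrite inE => aq fq; exists q.
have [|d [d220 lid]] := @li_edge_colorable_220 _ _ _ _ (src_neq_tgt ends) (simple_ends ends) _ c.
  by move=> a; apply/(color_class_li ends).
apply/existsP; exists [ffun f => inord (d f)]; apply/forallP => a.
apply/(color_class_li ends); rewrite (_ : [set f | _] = [set f in [set: edge G] | d f == a]) //.
apply/setP => f; rewrite !inE ffunE /=; apply/eqP/eqP => [<-|df].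
  by rewrite inordK // d220 ?inE.
by apply: val_inj; rewrite /= inordK ?df.
Qed.
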